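(* Consider the asymptotic regime $n\to\infty$, where $d$, $m$, the edge set $E$, the exponential family and $p^*$ (hence $\theta^*$) may depend on $n$. Assume that, with constants $\underline\epsilon,\bar\epsilon,c_1,c_2,\nu$ and sub-Gaussian norm bound not depending on $n$: 1. (eigenvalue bounds) for each $i\in V$, $\infty>\bar\epsilon\ge\Lambda_{\max}(\Gamma_i^* )\ge\Lambda_{\min}(\Gamma_i^* )\ge\underline\epsilon>0$; 2. (sparsity) $\theta^*_{ij}=0$ for all pairs $i\neq j$ with $(i,j)\in E^c$; 3. (concentration) for some $c_1,c_2,\nu>0$ and all $0\le t\le\nu$, every coordinate of $\widehat K$ satisfies $\mathbb P(|\widehat K_{ij}^u-(K^* )_{ij}^u|\ge t)\le\exp\{-c_1nt^2\}$, and every entry of $\widehat\Gamma_i$, $i\in V$, deviates from the corresponding entry of $\Gamma_i^*$ by at least $t$ in absolute value with probability at most $\exp\{-c_2nt^2\}$; 4. (sub-Gaussianity) for each $i\in V$ and $r=1,\dots,n$, $a_i(X^r)$ is a sub-Gaussian random vector. Suppose the regularization parameter is chosen as $$\lambda_n\asymp\sqrt{\frac{m\,\kappa_{1,\theta}^2\log(md)}{n}}$$ and the sample size satisfies $n=\Omega(md)$ (both with suitably large implied constants). Then any solution $\widehat\theta$ of the regularized score matching problem with $\lambda=\lambda_n$ satisfies $$\Vert\widehat\theta-\theta^*\Vert_2=O_p\left(\sqrt{\frac{(d+|E|)\,m\,\kappa_{1,\theta}^2\log(md)}{n}}\right).$$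
   Context: Setting. $V=\{1,\dots,d\}$; $E$ is a set of unordered pairs (edges) of distinct elements of $V$. A pairwise exponential family on $\mathbb R^d$ has densities $q_\theta(x)\propto\exp\{\sum_{i\le j}\langle\theta_{ij},\phi_{ij}(x)\rangle\}$, where $\phi_{ii}=(\phi_{ii}^u)_u$ is a vector of functions of $x_i$, $\phi_{ij}=(\phi_{ij}^u)_u$ a vector of functions of $(x_i,x_j)$, all twice differentiable, each group having at most $m$ components; by convention $\phi_{ij}=\phi_{ji}$, $\theta_{ij}=\theta_{ji}$. The vector $\theta$ stacks the groups $\theta_{ij}$, one for each $i\le j$. Write $\phi_{\cdot,i}=(\phi_{1i}^\top,\dots,\phi_{di}^\top)^\top$, $\theta_{\cdot,i}=(\theta_{1i}^\top,\dots,\theta_{di}^\top)^\top$. Let $a_i(x)=\partial\phi_{\cdot,i}(x)/\partial x_i$; let $A(x)$ be the symmetric positive semidefinite matrix with $\theta^\top A(x)\theta=\sum_{i\in V}(a_i(x)^\top\theta_{\cdot,i})^2$ for all $\theta$; let $K(x)$ be the vector (stacked like $\theta$) with groups $K_{ij}(x)=\partial^2\phi_{ij}/\partial x_i^2+1\{i\ne j\}\,\partial^2\phi_{ij}/\partial x_j^2$. (Then $\frac12\theta^\top A(x)\theta+K(x)^\top\theta$ is the Hyvärinen score $\frac12\Vert\nabla\log q_\theta\Vert_2^2+\Delta\log q_\theta$.) The data $X^1,\dots,X^n$ are i.i.d. from $p^*$, which need not belong to the family. Put $\widehat\Gamma=\frac1n\sum_rA(X^r)$, $\widehat K=\frac1n\sum_rK(X^r)$,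 $\widehat\Gamma_i=\frac1n\sum_ra_i(X^r)a_i(X^r)^\top$, $\Gamma^*=\mathbb E_{p^*}[A(X)]$, $K^*=\mathbb E_{p^*}[K(X)]$, $\Gamma_i^*=\mathbb E_{p^*}[a_i(X)a_i(X)^\top]$, and $\theta^*=-(\Gamma^* )^{-1}K^*$. $\Lambda_{\min},\Lambda_{\max}$ denote extreme eigenvalues. The regularized score matching estimator is any $$\widehat\theta\in\arg\min_\theta\Big\{\tfrac12\theta^\top\widehat\Gamma\theta+\widehat K^\top\theta+\lambda\mathcal R(\theta)\Big\},\qquad\mathcal R(\theta)=\sum_{i\le j}\Vert\theta_{ij}\Vert_2 .$$ $\kappa_{1,\theta}:=\max_{i\in V}\sum_{j\in V,\,u\le m}|(\theta^* )_{ij}^u|$.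
   Formalization: Two conditions are added, without which the claim fails: for all large n, κ_{1,θ} is at least a positive constant κ0 (on which the implied constants may depend), and md ≥ 2; otherwise λ_n and the bound can vanish or fall below the noise of K̂. *)

(* Defs.v *)
From HB Require Import structures.
From mathcomp Require Import all_boot all_order all_algebra.
From mathcomp Require Import all_classical all_reals all_analysis.

Set Implicit Arguments.
Unset Strict Implicit.
Unset Printing Implicit Defensive.

Import Order.TTheory GRing.Theory Num.Theory.
Import numFieldNormedType.Exports.

Local Open Scope classical_set_scope.
Local Open Scope ring_scope.

(* R^d with its Borel sigma-algebra; convertible to 'rV[R]_d *)
Definition borel_rV (R : realType) (d : nat) :=
  g_sigma_algebraType (@open 'rV[R]_d).

Definition partial (R : realType) (d : nat) (i : 'I_d) (f : 'rV[R]_d -> R)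
  (x : 'rV[R]_d) : R := 'D_(delta_mx 0 i) f x.

Definition twice_differentiable (R : realType) (d : nat) (f : 'rV[R]_d -> R) :=
  (forall x, differentiable f x) /\
  (forall (i : 'I_d) x, differentiable (partial i f) x).

(* [gsize i j] is the number of components of the group phi_ij: only the
   [phi i j u] with [u < gsize i j] belong to the family, the others are never
   used.  [width] is the uniform bound m on the group sizes.  The statistics
   phi_ij are functions on the whole space that depend on x_i and x_j only. *)
Record pairwise_family (R : realType) := PairwiseFamily {
  nvar : nat ;
  width : nat ;
  gsize : 'I_nvar -> 'I_nvar -> nat ;
  gsizeC : forall i j, gsize i j = gsize j i ;
  gsize_le : forall i j, (gsize i j <= width)%N ;
  phi : 'I_nvar -> 'I_nvar -> 'I_width -> 'rV[R]_nvar -> R ;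
  phiC : forall i j, phi i j = phi j i ;
  phi_local : forall i j u (x y : 'rV[R]_nvar),
    x 0 i = y 0 i -> x 0 j = y 0 j -> phi i j u x = phi i j u y ;
  phi_diff2 : forall i j u, twice_differentiable (phi i j u)
}.

Section family.
Variables (R : realType) (F : pairwise_family R).
Notation d := (nvar F).
Notation m := (width F).

(* coordinates ((i, j), u), i <= j, of the stacked vector theta *)
Definition pidx := {k : 'I_d * 'I_d * 'I_m |
  (k.1.1 <= k.1.2)%N && (k.2 < gsize k.1.1 k.1.2)%N}.

(* coordinates (j, u) of the vectors indexed by ". , i" *)
Definition cidx (i : 'I_d) := {c : 'I_d * 'I_m | (c.2 < gsize c.1 i)%N}.

Definition pdim : nat := #|{: pidx}|.
Definition cdim (i : 'I_d) : nat := #|{: cidx i}|.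

Definition group_of (k : 'I_pdim) : 'I_d * 'I_d := (val (enum_val k)).1.
Definition comp_of (k : 'I_pdim) : 'I_m := (val (enum_val k)).2.

Definition cvertex (i : 'I_d) (c : 'I_(cdim i)) : 'I_d := (val (enum_val c)).1.
Definition ccomp (i : 'I_d) (c : 'I_(cdim i)) : 'I_m := (val (enum_val c)).2.

Definition ordered_pair (i j : 'I_d) : 'I_d * 'I_d :=
  if (i <= j)%N then (i, j) else (j, i).

(* the 0-1 matrix of the linear map theta |-> theta_{.,i} *)
Definition col_sel (i : 'I_d) : 'M[R]_(cdim i, pdim) :=
  \matrix_(c, k) ((ordered_pair (cvertex c) i == group_of k) &&
                  (ccomp c == comp_of k))%:R.

Definition col_of (i : 'I_d) (theta : 'cV[R]_pdim) : 'cV[R]_(cdim i) :=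
  col_sel i *m theta.

Definition a_vec (i : 'I_d) (x : 'rV[R]_d) : 'cV[R]_(cdim i) :=
  \col_c partial i (phi (cvertex c) i (ccomp c)) x.

Lemma col_ofE (i : 'I_d) (theta : 'cV[R]_pdim) (c : 'I_(cdim i)) :
  exists k : 'I_pdim, [/\ group_of k = ordered_pair (cvertex c) i,
    comp_of k = ccomp c & col_of i theta c 0 = theta k 0].
Proof.
have Pk : (fun k : 'I_d * 'I_d * 'I_m =>
    (k.1.1 <= k.1.2)%N && (k.2 < gsize k.1.1 k.1.2)%N)
    (ordered_pair (cvertex c) i, ccomp c).
  have := valP (enum_val c); rewrite -/(cvertex c) -/(ccomp c) /ordered_pair /=.
  by case: (leqP (cvertex c) i) => [-> //|/ltnW ij]; rewrite /= ij gsizeC.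
pose k0 : pidx := Sub (ordered_pair (cvertex c) i, ccomp c) Pk.
exists (enum_rank k0).
rewrite /group_of /comp_of enum_rankK; split=> //.
rewrite mxE (bigD1 (enum_rank k0)) //= big1 ?addr0.
  by rewrite mxE /group_of /comp_of enum_rankK /= !eqxx mul1r.
move=> k kP; rewrite mxE; case: andP => [[/eqP gk /eqP ck]|]; last
  by rewrite mul0r.
case/eqP: kP; apply: (canRL enum_valK); apply: val_inj => /=.
by rewrite gk ck /group_of /comp_of -surjective_pairing.
Qed.

(* see [A_mx_sym] and [A_mx_quad] below *)
Definition A_mx (x : 'rV[R]_d) : 'M[R]_pdim :=
  \sum_(i < d) (col_sel i)^T *m (a_vec i x *m (a_vec i x)^T) *m col_sel i.

Definition K_vec (x : 'rV[R]_d) : 'cV[R]_pdim :=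
  \col_k (let: (i, j) := group_of k in let f := phi i j (comp_of k) in
    partial i (partial i f) x +
    (if i != j then partial j (partial j f) x else 0)).

Lemma A_mx_sym x : (A_mx x)^T = A_mx x.
Proof.
rewrite /A_mx raddf_sum; apply: eq_bigr => i _ /=.
by rewrite !trmx_mul !trmxK !mulmxA.
Qed.

Lemma A_mx_quad x (theta : 'cV[R]_pdim) :
  (theta^T *m A_mx x *m theta) 0 0 =
  \sum_(i < d) ((a_vec i x)^T *m col_of i theta) 0 0 ^+ 2.
Proof.
rewrite /A_mx mulmx_sumr mulmx_suml summxE; apply: eq_bigr => i _.
set y := (a_vec i x)^T *m col_of i theta.
have -> : theta^T *m ((col_sel i)^T *m (a_vec i x *m (a_vec i x)^T) *m
    col_sel i) *m theta = y^T *m y.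
  by rewrite /y /col_of !trmx_mul !trmxK !mulmxA.
by rewrite mxE big_ord1 mxE expr2.
Qed.

Definition group_norm (p : 'I_d * 'I_d) (theta : 'cV[R]_pdim) : R :=
  Num.sqrt (\sum_(k | group_of k == p) theta k 0 ^+ 2).

Definition penalty (theta : 'cV[R]_pdim) : R :=
  \sum_(p : 'I_d * 'I_d | (p.1 <= p.2)%N) group_norm p theta.

Definition kappa1 (theta : 'cV[R]_pdim) : R :=
  \big[Num.max/0]_(i < d) \sum_c `|col_of i theta c 0|.

Section population.
Variable pstar : probability (borel_rV R d) R.

Definition Gamma_star : 'M[R]_pdim :=
  \matrix_(k, l) fine 'E_pstar[(fun x => A_mx x k l)].

Definition K_star : 'cV[R]_pdim :=
  \col_k fine 'E_pstar[(fun x => K_vec x k 0)].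

Definition Gammai_star (i : 'I_d) : 'M[R]_(cdim i) :=
  \matrix_(k, l) fine 'E_pstar[(fun x => (a_vec i x *m (a_vec i x)^T) k l)].

Definition theta_star : 'cV[R]_pdim := - (invmx Gamma_star *m K_star).

End population.

Section sample.
Variables (n : nat) (x : 'I_n -> 'rV[R]_d).

Definition Gamma_hat : 'M[R]_pdim := n%:R^-1 *: \sum_(r < n) A_mx (x r).

Definition K_hat : 'cV[R]_pdim := n%:R^-1 *: \sum_(r < n) K_vec (x r).

Definition Gammai_hat (i : 'I_d) : 'M[R]_(cdim i) :=
  n%:R^-1 *: \sum_(r < n) (a_vec i (x r) *m (a_vec i (x r))^T).

Definition objective (lambda : R) (theta : 'cV[R]_pdim) : R :=
  2^-1 * (theta^T *m Gamma_hat *m theta) 0 0 + (K_hat^T *m theta) 0 0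
  + lambda * penalty theta.

Definition rsm_solutions (lambda : R) : set 'cV[R]_pdim :=
  [set th | forall theta, objective lambda th <= objective lambda theta].

End sample.

End family.

Definition l2norm (R : realType) (p : nat) (v : 'cV[R]_p) : R :=
  Num.sqrt (\sum_k v k 0 ^+ 2).

(* used for symmetric matrices of positive size only *)
Definition Lambda_max (R : realType) (p : nat) (A : 'M[R]_p) : R :=
  sup [set a | eigenvalue A a].

Definition Lambda_min (R : realType) (p : nat) (A : 'M[R]_p) : R :=
  inf [set a | eigenvalue A a].

Section probability_notions.
Context (disp : measure_display) (Omega : measurableType disp) (R : realType).
Variable P : probability Omega R.

Definition iid_sample (disp' : measure_display) (T : measurableType disp')
    (n : nat) (p : probability T R) (X : 'I_n -> {mfun Omega >-> T}) : Prop :=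
  (forall r B, measurable B -> distribution P (X r) B = p B) /\
  (forall B : 'I_n -> set T, (forall r, measurable (B r)) ->
    P (\bigcap_(r in [set: 'I_n]) X r @^-1` B r) =
    (\prod_(r < n) P (X r @^-1` B r))%E).

(* Y is a sub-Gaussian vector with psi_2-norm at most s: each one-dimensional
   marginal <v, Y>, v a unit vector, has inf {t > 0 | E exp((<v, Y>/t)^2) <= 2}
   at most s.  No centring is assumed. *)
Definition subgaussian_vec (p : nat) (Y : Omega -> 'cV[R]_p) (s : R) : Prop :=
  forall v : 'cV[R]_p, l2norm v = 1 ->
    ('E_P[(fun w => expR (((v^T *m Y w) 0 0 / s) ^+ 2))%R] <= 2%:E)%E.

End probability_notions.

(* Z = O_p(rate), for a statistic that need not be single-valued or measurable:
   [Z n w] is the set of its possible values at the outcome w.  For every eps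
   there is M such that for all large n, outside an event of probability at most
   eps, all these values are at most M * rate n. *)
Definition bigO_p (R : realType) (disp : nat -> measure_display)
    (Omega : forall n, measurableType (disp n))
    (P : forall n, probability (Omega n) R)
    (Z : forall n, Omega n -> set R) (rate : nat -> R) : Prop :=
  forall eps : R, 0 < eps -> exists2 M : R, 0 < M &
    \forall n \near \oo, exists A : set (Omega n),
      [/\ measurable A, (P n A <= eps%:E)%E &
          forall w, ~ A w -> forall z, Z n w z -> `|z| <= M * rate n].

(* Main.v *)
Require Import Defs.
From HB Require Import structures.
From mathcomp Require Import all_boot all_order all_algebra.
From mathcomp Require Import all_classical all_reals all_analysis.
From mathcomp Require Import measurable_realfun.
From mathcomp Require Import ring lra zify.

Set Implicit Arguments.
Unset Strict Implicit.
Unset Printing Implicit Defensive.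

Import Order.TTheory GRing.Theory Num.Theory.
Import numFieldNormedType.Exports.

Local Open Scope classical_set_scope.
Local Open Scope ring_scope.

(** The estimator minimizes a quadratic loss plus a group-lasso penalty, and the
    proof is the usual one for such problems. Comparing the objective at a
    solution and at [theta_star], with [Delta] their difference, gives
    ([oracle_inequality])
      [rho / 2 * |Delta|^2 <= (gamma + lambda) * sum_S |Delta_p|
                              + (gamma - lambda) * sum_notS |Delta_p|],
    where [rho] is the curvature of the empirical loss, [gamma] bounds the
    groups of its gradient [Gamma_hat theta_star + K_hat] at [theta_star], and [S] is
    the set of groups in which [theta_star] may be nonzero, at most [d + |E|] of
    them. If [gamma <= lambda], Cauchy-Schwarz on the first sum gives the rate.

    Gradient. As [Gamma_star theta_star = - K_star], the gradient is
    [(Gamma_hat - Gamma_star) theta_star + (K_hat - K_star)]. A union bound over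
    the at most [2 (m d)^3] entries makes all deviations at most
    [t = tau * sqrt (ln (m d) / n)], and [theta_star] multiplies the former
    by its column norms [kappa], so [gamma] is of order [sqrt m * kappa * t],
    the order of [lambda]. The probability of failure is a negative power of
    [m d]. It need not be small when [m d] stays bounded; but then there are
    boundedly many groups, so [S] may be replaced by the set of all groups,
    where nothing has to be absorbed, and [tau] may be chosen large depending on
    the probability that is aimed at.

    Curvature. [Gamma_hat] is assembled from the matrices [Gammai_hat i] of size
    at most [m d], and it suffices to bound these below. For a fixed direction
    the fourth moments of a sub-Gaussian vector and the eigenvalue bound yield,
    by Paley-Zygmund, that an observation is far from the orthogonal hyperplane
    with probability at least [beta] ([small_ball]); by Chernoff a proportion
    [beta / 4] of the sample is far from it except with probability
    [exp (- n beta / 4)] ([few_visits_le]). This is uniform over a grid of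
    [exp (O (m d))] directions because [n] is at least a large multiple of
    [m d]. Rounding an arbitrary vector to the grid coordinate by coordinate
    increases the quadratic form by at most the trace ([grid_qform_lower]), and
    the trace is [O (m d)] since the diagonal entries concentrate. *)

(** * Quadratic forms and their smallest eigenvalue *)

Definition sqn (R : realType) (p : nat) (v : 'cV[R]_p) : R :=
  \sum_k v k 0 ^+ 2.

Definition qform (R : realType) (p : nat) (A : 'M[R]_p) (v : 'cV[R]_p) : R :=
  (v^T *m A *m v) 0 0.

Section quadratic_forms.
Variables (R : realType) (p : nat).
Implicit Types (A B : 'M[R]_p) (u v : 'cV[R]_p).

Lemma l2normE v : l2norm v = Num.sqrt (sqn v).
Proof. by []. Qed.

Lemma sqn_ge0 v : 0 <= sqn v.
Proof. by apply: sumr_ge0 => k _; exact: sqr_ge0. Qed.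

Lemma sqnE v : sqn v = (v^T *m v) 0 0.
Proof. by rewrite mxE; apply: eq_bigr => k _; rewrite mxE expr2. Qed.

Lemma sqn_eq0 v : sqn v = 0 -> v = 0.
Proof.
move=> /eqP; rewrite psumr_eq0 => [/allP h|k _]; last exact: sqr_ge0.
apply/colP => k; rewrite mxE; apply/eqP; rewrite -sqrf_eq0.
by have := h k (mem_index_enum k).
Qed.

Lemma sqnZ a v : sqn (a *: v) = a ^+ 2 * sqn v.
Proof.
by rewrite /sqn mulr_sumr; apply: eq_bigr => k _; rewrite mxE exprMn.
Qed.

Lemma qformE A v : qform A v = \sum_k \sum_l A k l * (v k 0 * v l 0).
Proof.
rewrite /qform mxE exchange_big; apply: eq_bigr => l _.
rewrite mxE mulr_suml; apply: eq_bigr => k _.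
by rewrite !mxE; ring.
Qed.

Lemma qformZ A a v : qform A (a *: v) = a ^+ 2 * qform A v.
Proof.
rewrite !qformE mulr_sumr; apply: eq_bigr => k _; rewrite mulr_sumr.
by apply: eq_bigr => l _; rewrite !mxE; ring.
Qed.

Lemma qform0 A : qform A 0 = 0.
Proof. by rewrite /qform mulmx0 mxE. Qed.

Lemma qform_le_sum A v : `|qform A v| <= (\sum_k \sum_l `|A k l|) * sqn v.
Proof.
rewrite qformE mulr_suml (le_trans (ler_norm_sum _ _ _))//.
apply: ler_sum => k _; rewrite mulr_suml (le_trans (ler_norm_sum _ _ _))//.
apply: ler_sum => l _; rewrite normrM ler_wpM2l// normrM.
have coord i : v i 0 ^+ 2 <= sqn v.
  by rewrite /sqn (bigD1 i)//= lerDl sumr_ge0// => j _; exact: sqr_ge0.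
have := coord k; have := coord l; rewrite -(real_normK (num_real (v k 0))).
rewrite -(real_normK (num_real (v l 0))).
have := sqr_ge0 (`|v k 0| - `|v l 0|); nra.
Qed.

Lemma qform_subM A a v : qform (A - a%:M) v = qform A v - a * sqn v.
Proof.
by rewrite /qform mulmxBr mulmxBl mul_mx_scalar -scalemxAl sqnE !mxE.
Qed.

(** Testing the form at [x - s B x] and taking [s] small gives
    [|B x|^2 <= C <x, B x>], and [|x| <= |B^-1| |B x|]. *)
Lemma psd_unit_gap B : B^T = B -> B \in unitmx ->
  (forall v, 0 <= qform B v) ->
  exists2 g : R, 0 < g & forall v, g * sqn v <= qform B v.
Proof.
move=> Bsym Bunit Bpsd.
pose C := 1 + \sum_k \sum_l `|B k l|.
pose D := 1 + \sum_k \sum_l `|((invmx B)^T *m invmx B) k l|.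
have sum_ge0 (M : 'M[R]_p) : 0 <= \sum_k \sum_l `|M k l|.
  by apply: sumr_ge0 => k _; apply: sumr_ge0.
have C1 : 1 <= C by rewrite lerDl.
have D1 : 1 <= D by rewrite lerDl.
have C0 : 0 < C by lra.
have D0 : 0 < D by lra.
exists (C * D)^-1; first by rewrite invr_gt0 mulr_gt0.
move=> v; set w := B *m v.
have qBw : qform B w <= C * sqn w.
  rewrite (le_trans (ler_norm _))// (le_trans (qform_le_sum _ _))//.
  by rewrite ler_wpM2r ?sqn_ge0// lerDr.
have svw : sqn v <= D * sqn w.
  have -> : sqn v = qform ((invmx B)^T *m invmx B) w.
    by rewrite sqnE /qform /w -!mulmxA mulmxA -trmx_mul !mulKmx.
  rewrite (le_trans (ler_norm _))// (le_trans (qform_le_sum _ _))//.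
  by rewrite ler_wpM2r ?sqn_ge0// lerDr.
have /(_ C^-1) expand s :
    qform B (v - s *: w) = qform B v - 2 * s * sqn w + s ^+ 2 * qform B w.
  rewrite /qform; have -> : (v - s *: w)^T = v^T - s *: w^T.
    by rewrite linearB linearZ.
  rewrite !mulmxBl !mulmxBr -!scalemxAr -!scalemxAl.
  have -> : v^T *m B *m w = w^T *m w by rewrite /w trmx_mul Bsym.
  have -> : w^T *m B *m v = w^T *m w by rewrite -mulmxA.
  rewrite !mxE sqnE mxE; ring.
have := Bpsd (v - C^-1 *: w); rewrite expand => hpos.
have CV : C^-1 * C = 1 by rewrite mulVf// gt_eqF.
have CV0 : 0 < C^-1 by rewrite invr_gt0.
have h1 : C^-1 ^+ 2 * qform B w <= C^-1 * sqn w.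
  by rewrite expr2 -mulrA ler_pM2l// ler_pdivrMl.
rewrite ler_pdivrMl ?mulr_gt0// (le_trans svw)//.
have -> : C * D * qform B v = D * (C * qform B v) by ring.
rewrite ler_pM2l// -ler_pdivrMl//; lra.
Qed.

(** The infimum [mu] of the Rayleigh quotients of [A] is an eigenvalue:
    otherwise [A - mu] would be positive semidefinite and invertible, and [psd_unit_gap]
    would allow [mu] to be increased. *)
Lemma sym_eigenvalue_qform A (e : R) : A^T = A ->
  (forall a, eigenvalue A a -> e <= a) -> forall v, e * sqn v <= qform A v.
Proof.
move=> Asym Aeig.
pose S := [set a : R | forall v, a * sqn v <= qform A v].
have S0 : S !=set0.
  exists (- \sum_k \sum_l `|A k l|) => v.
  by have := qform_le_sum A v; rewrite ler_norml mulNr => /andP[].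
have [p0|[v0 v0P]] : (forall v, sqn v = 0) \/ (exists v, 0 < sqn v).
  have [?|/forallNP h] := pselect (exists v : 'cV[R]_p, 0 < sqn v).
    by right.
  by left=> v; apply/eqP; rewrite eq_le sqn_ge0 andbT leNgt; apply/negP/h.
  by move=> v; rewrite p0 mulr0 (sqn_eq0 (p0 v)) qform0.
have Sub : has_ubound S.
  by exists (qform A v0 / sqn v0) => a /(_ v0); rewrite ler_pdivlMr.
have supS : S (sup S).
  move=> v; have [v_eq0|v_neq0] := eqVneq (sqn v) 0.
    by have [a /(_ v)] := S0; rewrite v_eq0 !mulr0.
  have v_gt0 : 0 < sqn v by rewrite lt_def v_neq0 sqn_ge0.
  rewrite -ler_pdivlMr//; apply: ge_sup => // a /(_ v).
  by rewrite ler_pdivlMr.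
have eigS : eigenvalue A (sup S).
  apply: contrapT => /negP; rewrite negbK kermx_eq0 row_free_unit => unitA.
  have sym : (A - (sup S)%:M)^T = A - (sup S)%:M.
    by rewrite linearB /= Asym tr_scalar_mx.
  have [|g g0 gP] := psd_unit_gap sym unitA.
    by move=> v; rewrite qform_subM subr_ge0.
  have : S (sup S + g).
    by move=> v; have := gP v; rewrite qform_subM; lra.
  by move=> /(ub_le_sup Sub); rewrite gerDl leNgt g0.
by move=> v; rewrite (le_trans _ (supS v))// ler_wpM2r ?sqn_ge0// Aeig.
Qed.

(** [inf] takes the value [0] on sets that are empty or unbounded below; the
    hypothesis [0 < e] excludes these cases. *)
Lemma Lambda_min_qform A (e : R) : A^T = A -> 0 < e -> e <= Lambda_min A ->
  forall v, e * sqn v <= qform A v.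
Proof.
move=> Asym e0 eA; apply: sym_eigenvalue_qform => // a aA.
have [[_ lbA]|/inf_out A0] := pselect (has_inf [set b | eigenvalue A b]).
  exact: (le_trans eA (ge_inf lbA aA)).
by move: eA; rewrite /Lambda_min A0 leNgt e0.
Qed.

End quadratic_forms.

(** * Positivity of a quadratic form from its values on an integer grid *)

(** The lattice points of [l^1]-norm at most [D * p]. A coordinate is a sign and
    a magnitude, so that sums over all points factorise over a finite type;
    [0] has two codes. *)
Definition grid (p D : nat) : {set {ffun 'I_p -> bool * 'I_(D * p).+1}} :=
  [set f : {ffun 'I_p -> bool * 'I_(D * p).+1} |
    (\sum_k (f k).2 <= D * p)%N]%SET.

Definition grid_pt (R : realType) (p N : nat) (f : {ffun 'I_p -> bool * 'I_N}) :
  'cV[R]_p := \col_k ((-1) ^+ (f k).1 * ((f k).2 : nat)%:R).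

Section grid.
Variable R : realType.

(** Each point [z] of the grid has weight at least [1] under
    [2 ^ (D * p - |z|_1)], whose sum over all [z] factorises over the
    coordinates into factors at most [4]. *)
Lemma card_grid (p D : nat) : (#|grid p D| <= 2 ^ ((D + 2) * p))%N.
Proof.
set N := (D * p).+1.
rewrite -(ler_nat R) -sum1_card natr_sum.
pose h (c : bool * 'I_N) : R := 2^-1 ^+ (c.2 : nat).
have h0 c : 0 <= h c by rewrite exprn_ge0.
have hN0 (f : {ffun 'I_p -> bool * 'I_N}) :
    0 <= 2 ^+ (D * p) * \prod_k h (f k).
  by rewrite mulr_ge0 ?exprn_ge0// prodr_ge0.
apply: (@le_trans _ _ (\sum_(f : {ffun 'I_p -> bool * 'I_N})
    2 ^+ (D * p) * \prod_(k < p) h (f k))).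
  rewrite [leRHS](bigID (mem (grid p D)))/= -[leLHS]addr0 lerD//.
    apply: ler_sum => f; rewrite inE => fG.
    rewrite /h prodrXr -{1}(subnK fG) exprD -mulrA -exprMn divff ?pnatr_eq0//.
    by rewrite expr1n mulr1 exprn_ege1// ler1n.
  by apply: sumr_ge0.
rewrite -mulr_sumr -(bigA_distr_bigA (fun (_ : 'I_p) c => h c)) /=.
rewrite natrX mulnDl exprD ler_wpM2l ?exprn_ge0//.
rewrite exprM -[X in _ <= _ ^+ X]card_ord -prodr_const ler_prod// => k _.
apply/andP; split; first exact: sumr_ge0.
rewrite -(pair_bigA _ (fun (b : bool) (j : 'I_N) => 2^-1 ^+ j : R)) /=.
rewrite big_bool /=.
have : \sum_(j < N) 2^-1 ^+ j <= 2 :> R.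
  have : 0 <= 2^-1 ^+ N :> R by rewrite exprn_ge0.
  have := subrX1 (2^-1 : R) N; set s := \sum_(i < N) _; lra.
lra.
Qed.

Lemma qform_delta (p : nat) (G : 'M[R]_p) (u : 'cV_p) (k : 'I_p) :
  exists b : R, forall s,
  qform G (u + s *: delta_mx k 0) = qform G u + s * b + s ^+ 2 * G k k.
Proof.
set e : 'cV_p := delta_mx k 0.
exists ((e^T *m G *m u) 0 0 + (u^T *m G *m e) 0 0) => s.
rewrite /qform; have -> : (u + s *: e)^T = u^T + s *: e^T.
  by rewrite linearD linearZ.
rewrite !mulmxDl !mulmxDr -!scalemxAr -!scalemxAl.
have -> : G k k = (e^T *m G *m e) 0 0.
  by rewrite /e trmx_delta -rowE -colE !mxE.
move: (e^T *m G *m e) (e^T *m G *m u) (u^T *m G *m e) (u^T *m G *m u).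
by move=> m1 m2 m3 m4; rewrite !mxE; ring.
Qed.

(** Choosing one of the two neighbouring integers at random, with mean [u k],
    leaves the linear part unchanged and adds at most [G k k] on average to the
    form; so one of the two choices adds at most that. *)
Lemma round_coordinate (p : nat) (G : 'M[R]_p) (u : 'cV_p) (k : 'I_p) :
  0 <= G k k -> exists z : int, `|z%:~R - u k 0| <= 1 /\
    qform G (u + (z%:~R - u k 0) *: delta_mx k 0) <= qform G u + G k k.
Proof.
move=> Gkk; have [b Eb] := qform_delta G u k.
set q := Num.floor (u k 0).
have fl : q%:~R <= u k 0 by exact: floor_le.
have fg : u k 0 < (q + 1)%:~R by exact: floorD1_gt.
have := Eb (q%:~R - u k 0); have := Eb ((q + 1)%:~R - u k 0).
move: fg; rewrite intrD; set x := u k 0 in fl *; set y := q%:~R in fl *.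
move=> fg E1 E0.
have [E|E] := leP (qform G (u + (y - x) *: delta_mx k 0)) (qform G u + G k k).
  by exists q; split; [rewrite ler_norml; lra|].
exists (q + 1); rewrite intrD; split; first by rewrite ler_norml /=; lra.
rewrite {}E1; rewrite {}E0 in E; move: E Gkk; set g := G k k.
have -> : y + 1%:~R - x = 1 - (x - y) by rewrite mulr1z; ring.
have -> : y - x = - (x - y) by ring.
have [f0 f1] : 0 <= x - y /\ x - y < 1 by split; lra.
move: (x - y) f0 f1 (qform G u) => f f0 f1 q0 E Gkk.
have {}f0 : 0 < f.
  by rewrite lt_def f0 andbT; apply/eqP => f_eq0; rewrite f_eq0 in E; lra.
have h1 : (1 - f) * (f * b) <= (1 - f) * ((f ^+ 2 - 1) * g).
  by apply: ler_wpM2l; lra.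
have h2 : 0 <= (1 - f) ^+ 2 * g by rewrite mulr_ge0// sqr_ge0.
have h3 : 0 <= f * g by rewrite mulr_ge0// ltW.
suff : f * ((1 - f) * b + (1 - f) ^+ 2 * g - g) <= 0.
  by rewrite pmulr_rle0//; lra.
nra.
Qed.

Lemma round_coordinates (p : nat) (G : 'M[R]_p) (u : 'cV_p) (s : seq 'I_p) :
  uniq s -> (forall k, 0 <= G k k) -> exists v : 'cV_p,
  [/\ forall k, k \in s -> exists z : int, v k 0 = z%:~R,
      forall k, k \notin s -> v k 0 = u k 0,
      forall k, `|v k 0 - u k 0| <= 1 &
      qform G v <= qform G u + \sum_(k <- s) G k k].
Proof.
move=> us G0; elim: s us => [_|k s IH /= /andP[ks /IH[v [vs vN vu vq]]]].
  by exists u; split=> // [k|]; rewrite ?subrr ?normr0// big_nil addr0.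
have [z [zv zq]] := round_coordinate v (G0 k).
exists (v + (z%:~R - v k 0) *: delta_mx k 0).
have E l : (v + (z%:~R - v k 0) *: delta_mx k 0) l 0 =
           if l == k then z%:~R else v l 0.
  rewrite !mxE eqxx andbT.
  by case: eqVneq => [->|_]; rewrite /= ?mulr1 ?mulr0; ring.
split=> [l|l|l|].
- rewrite E inE; case: eqVneq => [_ _|_ /vs//]; by exists z.
- by rewrite E inE; case: eqVneq => //= _ /vN.
- by rewrite E; case: eqVneq => [->|_]; [rewrite -(vN k ks)|exact: vu].
- by rewrite big_cons (le_trans zq)//; lra.
Qed.

Lemma integer_grid_pt (p D : nat) (v : 'cV[R]_p) :
  (forall k, exists z : int, v k 0 = z%:~R) -> sqn v <= (D * p)%:R ->
  exists2 f, f \in grid p D & v = grid_pt R f.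
Proof.
move=> /choice[z zv] vD.
have zD : (\sum_k `|z k| <= D * p)%N.
  rewrite -(ler_nat R) (le_trans _ vD)// natr_sum; apply: ler_sum => k _.
  have -> : v k 0 ^+ 2 = (`|z k| ^ 2)%:R.
    by rewrite natrX natr_absz intr_norm real_normK ?num_real// zv.
  by rewrite ler_nat; case: `|z k|%N => // i; rewrite -mulnn leq_pmulr.
pose f : {ffun 'I_p -> bool * 'I_(D * p).+1} :=
  [ffun k => (z k < 0, inord `|z k|%N)].
have fE k : ((f k).2 : nat) = `|z k|%N.
  rewrite ffunE /= inordK// ltnS (leq_trans _ zD)//.
  by rewrite (bigD1 k)//= leq_addr.
exists f; first by rewrite inE (eq_bigr _ (fun k _ => fE k)).
apply/colP => k; rewrite mxE fE zv ffunE /=.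
by rewrite -{1}(mulz_sign_abs (z k)) rmorphM /= rmorph_sign.
Qed.

Lemma sqr_near_le (x y : R) : `|y - x| <= 1 ->
  x ^+ 2 / 2 - 1 <= y ^+ 2 <= 2 * x ^+ 2 + 2.
Proof.
move=> h; have h1 : (y - x) ^+ 2 <= 1.
  by rewrite -(real_normK (num_real (y - x))) expr_le1.
by have := sqr_ge0 (2 * x - y); have := sqr_ge0 (2 * y - x); nra.
Qed.

(** Scale a point [x] so that its squared norm is [K * p] and round it to the
    integer lattice: the form moves by at most its trace, which is negligible
    against [K * p] when the trace is at most a constant times the dimension. *)
Lemma grid_qform_lower (p K : nat) (G : 'M[R]_p) (b T : R) :
  0 < b -> (4 <= K)%N -> 8 * T <= b * K%:R ->
  (forall k, 0 <= G k k) -> \tr G <= p%:R * T ->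
  (forall f, f \in grid p (4 * K) ->
     b * sqn (grid_pt R f) <= qform G (grid_pt R f)) ->
  forall x, b / 8 * sqn x <= qform G x.
Proof.
move=> b0 K4 KT G0 trG Ggrid x.
have [x0|x_neq0] := eqVneq (sqn x) 0.
  by rewrite x0 (sqn_eq0 x0) qform0 mulr0.
have x_gt0 : 0 < sqn x by rewrite lt_def x_neq0 sqn_ge0.
have p_gt0 : (0 < p)%N.
  case: p x x_neq0 {G G0 trG Ggrid x_gt0} => // x.
  by rewrite /sqn big_ord0 eqxx.
have pR : 0 < p%:R :> R by rewrite ltr0n.
have KR : 4 <= K%:R :> R by rewrite (ler_nat _ 4).
set c := K%:R * p%:R / sqn x.
have c0 : 0 < c by rewrite !mulr_gt0 ?invr_gt0//; lra.
pose u := Num.sqrt c *: x.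
have su : sqn u = K%:R * p%:R by rewrite sqnZ sqr_sqrtr ?ltW// /c mulfVK.
have qu : qform G u = c * qform G x by rewrite qformZ sqr_sqrtr ?ltW.
have [v [vint _ vu vq]] := round_coordinates u (index_enum_uniq _) G0.
have vint' k : exists z : int, v k 0 = z%:~R.
  by apply: vint; rewrite mem_index_enum.
have pE : p%:R = \sum_(k < p) 1 :> R by rewrite sumr_const card_ord.
have sv_lo : sqn u / 2 - p%:R <= sqn v.
  rewrite pE /sqn mulr_suml -sumrB.
  by apply: ler_sum => k _; have /andP[] := sqr_near_le (vu k).
have sv_hi : sqn v <= 2 * sqn u + 2 * p%:R.
  rewrite pE /sqn mulr_sumr mulr_sumr -big_split.
  by apply: ler_sum => k _; have /andP[_] := sqr_near_le (vu k); rewrite mulr1.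
have sv4 : sqn v <= (4 * K * p)%:R.
  by rewrite (le_trans sv_hi)// su !natrM; nra.
have [f fG vf] := integer_grid_pt vint' sv4.
move=> {vint vint' vu}; have := Ggrid _ fG; rewrite -vf => bv.
have main : b * (K%:R * p%:R) / 8 <= c * qform G x.
  rewrite -qu; rewrite su in sv_lo; move: vq; rewrite -/(\tr G) => vq.
  have h1 : b * (K%:R * p%:R / 4) <= b * sqn v.
    by rewrite ler_pM2l//; nra.
  have h2 : p%:R * T <= b * K%:R * p%:R / 8 by nra.
  lra.
rewrite -(ler_pM2l c0) (le_trans _ main)// /c.
have -> : K%:R * p%:R / sqn x * (b / 8 * sqn x) =
  b * (K%:R * p%:R) / 8 * (sqn x / sqn x) by ring.
by rewrite divff// mulr1.
Qed.

End grid.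

(** * Lower tail of the number of visits of an i.i.d. sample to a set *)

Section visits.
Variables (R : realType) (disp disp' : measure_display).
Variables (Omega : measurableType disp) (P : probability Omega R).

Lemma bigsetUP (I : finType) (U : Type) (Q : pred I) (A : I -> set U) (x : U) :
  (\big[setU/set0]_(i | Q i) A i) x <-> exists2 i, Q i & A i x.
Proof.
split=> [|[i Qi Ax]]; last by rewrite (bigD1 i)//=; left.
by elim/big_rec: _ => // i B Qi IH [Ax|/IH//]; exists i.
Qed.

Lemma prob_bigsetU_le (I : Type) (s : seq I) (Q : pred I) (A : I -> set Omega) :
  (forall i, measurable (A i)) ->
  (P (\big[setU/set0]_(i <- s | Q i) A i) <= \sum_(i <- s | Q i) P (A i))%E.
Proof.
move=> mA; elim: s => [|i s IH]; first by rewrite !big_nil measure0.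
rewrite !big_cons; case: ifP => // _.
have mU : measurable (\big[setU/set0]_(j <- s | Q j) A j).
  by apply: bigsetU_measurable => j _; exact: mA.
by rewrite (le_trans (measureU2 P (mA i) mU))// leeD2l.
Qed.

Lemma prob_bigsetU_le_const (I : finType) (Q : pred I) (A : I -> set Omega)
    (c : R) : 0 <= c ->
  (forall i, measurable (A i)) -> (forall i, Q i -> (P (A i) <= c%:E)%E) ->
  (P (\big[setU/set0]_(i | Q i) A i) <= (#|Q|%:R * c)%:E)%E.
Proof.
move=> c0 mA PA; rewrite (le_trans (prob_bigsetU_le _ _ mA))//.
apply: (@le_trans _ _ (\sum_(i | Q i) c%:E)%E); first exact: lee_sum.
by rewrite sumEFin lee_fin sumr_const mulr_natl.
Qed.

Variables (T : measurableType disp') (p : probability T R) (n : nat).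
Variable X : 'I_n -> {mfun Omega >-> T}.

Definition visits (B : set T) (w : Omega) : {set 'I_n} :=
  [set r : 'I_n | `[< B (X r w) >]]%SET.

Definition few_visits (B : set T) (t : R) : set Omega :=
  [set w | #|visits B w|%:R <= t].

Let cell (B : set T) (S : {set 'I_n}) : set Omega :=
  \bigcap_(r in [set: 'I_n]) X r @^-1` (if r \in S then B else ~` B).

Let few_visitsE B t :
  few_visits B t = \big[setU/set0]_(S : {set 'I_n} | #|S|%:R <= t) cell B S.
Proof.
have cellP S w : cell B S w <-> visits B w = S.
  split=> [Sw|<- r _]; last by rewrite /= inE; case: asboolP.
  apply/setP => r; rewrite inE; have := Sw r Logic.I => /=.
  by case: (r \in S) => h; apply/asboolP.
apply/seteqP; split=> w.
  by move=> wt; apply/bigsetUP; exists (visits B w); last exact/cellP.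
by move=> /bigsetUP[S St /cellP wS]; rewrite /few_visits /= wS.
Qed.

Let measurable_cell B S : measurable B -> measurable (cell B S).
Proof.
move=> mB; apply: fin_bigcap_measurable => [|r _]; first exact: finite_finset.
rewrite -[_ @^-1` _]setTI; apply: measurable_funP => //.
by case: ifP => // _; exact: measurableC.
Qed.

Lemma measurable_few_visits B t : measurable B -> measurable (few_visits B t).
Proof.
move=> mB; rewrite few_visitsE; apply: bigsetU_measurable => S _.
exact: measurable_cell.
Qed.

(** Chernoff bound for the binomial distribution: the visited sets [S] with
    [#|S| <= k] have weight at least [1] under [exp (k - #|S|)], and the total
    probability with these weights is [e^k (1 - q + q / e)^n] if [B] has
    probability [q]. *)
Lemma few_visits_le (B : set T) (b : R) : iid_sample P p X ->
  measurable B -> (b%:E <= p B)%E ->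
  (P (few_visits B (n%:R * b / 4)) <= (expR (- (n%:R * b / 4)))%:E)%E.
Proof.
move=> [Xp Xind] mB bB; set k := n%:R * b / 4.
pose q := fine (p B); have pB : p B = q%:E by rewrite fineK// fin_num_measure.
have pBC : p (~` B) = (1 - q)%:E by rewrite probability_setC// pB.
have bq : b <= q by rewrite -lee_fin -pB.
have q0 : 0 <= q by rewrite -lee_fin -pB; exact: measure_ge0.
have q1 : q <= 1 by rewrite -lee_fin -pB probability_le1.
have Pcell S : P (cell B S) = (\prod_(r < n) (if r \in S then q else 1 - q))%:E.
  rewrite Xind => [|r]; last by case: ifP => // _; exact: measurableC.
  rewrite -prodEFin; apply: eq_bigr => r _.
  have := Xp r; rewrite /distribution /pushforward => {}Xp.
  by case: ifP => _; rewrite Xp// ?pB ?pBC//; exact: measurableC.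
rewrite few_visitsE (le_trans (prob_bigsetU_le _ _ _))//.
  by move=> S; exact: measurable_cell.
rewrite (eq_bigr _ (fun S _ => Pcell S)) sumEFin lee_fin.
pose e1 : R := expR (-1).
have e1_gt0 : 0 < e1 by exact: expR_gt0.
have e1_le : e1 <= 1 / 2.
  rewrite /e1 expRN div1r lef_pV2 ?posrE ?expR_gt0//.
  by have := expR_ge1Dx (1 : R); lra.
have w_ge0 (S : {set 'I_n}) :
    0 <= expR k * \prod_(r < n) (if r \in S then q * e1 else 1 - q).
  rewrite mulr_ge0 ?expR_ge0// prodr_ge0// => r _; case: ifP => _; last lra.
  by rewrite mulr_ge0// ltW.
apply: (@le_trans _ _ (\sum_(S : {set 'I_n}) expR k *
    \prod_(r < n) (if r \in S then q * e1 else 1 - q))).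
  rewrite [leRHS](bigID (fun S : {set 'I_n} => #|S|%:R <= k))/= -[leLHS]addr0.
  rewrite lerD ?sumr_ge0//; apply: ler_sum => S Sk.
  have -> : \prod_(r < n) (if r \in S then q * e1 else 1 - q) =
    e1 ^+ #|S| * \prod_(r < n) (if r \in S then q else 1 - q).
    rewrite (bigID (mem S))/= [in RHS](bigID (mem S))/= mulrA; congr (_ * _).
      rewrite -prodr_const mulrC -big_split /=.
      by apply: eq_bigr => r rS; rewrite rS.
    by apply: eq_bigr => r /negbTE ->.
  rewrite mulrA ler_peMl//.
    by rewrite prodr_ge0// => r _; case: ifP => _; lra.
  rewrite /e1 -expRM_natl -expRD (le_trans _ (expR_ge1Dx _))//; lra.
rewrite -mulr_sumr -(bigA_distr 1 _ (fun _ => q * e1) (fun _ => 1 - q)).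
rewrite prodr_const card_ord /=.
have h : q * e1 + (1 - q) <= expR (- (q / 2)).
  have qe1 : q * e1 <= q * (1 / 2) by rewrite ler_wpM2l.
  by rewrite (le_trans _ (expR_ge1Dx _))//; lra.
apply: (@le_trans _ _ (expR k * expR (- (q / 2)) ^+ n)).
  have qe0 : 0 <= q * e1 by rewrite mulr_ge0// ltW.
  rewrite ler_pM2l ?expR_gt0//; apply: lerXn2r => //.
    by rewrite nnegrE; lra.
  by rewrite nnegrE expR_ge0.
rewrite -expRM_natl -expRD ler_expR /k.
have : n%:R * b <= n%:R * q by rewrite ler_wpM2l.
lra.
Qed.

End visits.

(** * Second moments and small balls of sub-Gaussian vectors *)

Section moments.
Variables (R : realType) (disp : measure_display) (T : measurableType disp).
Variable mu : probability T R.
Local Notation intg f := (mu.-integrable [set: T] (EFin \o f)).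

Lemma fine_expectation (f : T -> R) : fine 'E_mu[f] = \int[mu]_x f x.
Proof. by rewrite unlock. Qed.

Lemma intg_lin (I : finType) (c : I -> R) (f : I -> T -> R) :
  (forall i, intg (f i)) -> intg (fun x => \sum_i c i * f i x).
Proof.
move=> fi; rewrite (_ : _ \o _ = fun x => (\sum_i ((c i)%:E * (f i x)%:E))%E).
  by apply: integrable_sum => // i _; apply: integrableZl => //; exact: fi.
by apply/funext => x /=; rewrite -sumEFin.
Qed.

Lemma Rintegral_lin (I : finType) (c : I -> R) (f : I -> T -> R) :
  (forall i, intg (f i)) ->
  \int[mu]_x (\sum_i c i * f i x) = \sum_i c i * \int[mu]_x f i x.
Proof.
move=> fi; rewrite /Rintegral.
rewrite (_ : (fun x => _) = fun x => (\sum_i ((c i)%:E * (f i x)%:E))%E); last first.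
  by apply/funext => x /=; rewrite -sumEFin.
rewrite integral_sum => [|//|i]; last by apply: integrableZl => //; exact: fi.
rewrite -sum_fine => [|i _]; last first.
  by apply: integrable_fin_num => //; apply: integrableZl => //; exact: fi.
apply: eq_bigr => i _; rewrite integralZl//; last exact: fi.
by rewrite fineM// ?integrable_fin_num//; exact: fi.
Qed.

Lemma intg_le (f g : T -> R) : measurable_fun [set: T] f ->
  (forall x, `|f x| <= g x) -> intg g -> intg f.
Proof.
move=> mf fg gi; apply: le_integrable gi => //; first exact/measurable_EFinP.
by move=> x _ /=; rewrite lee_fin (le_trans (fg x))// ler_norm.
Qed.

Variables (p : nat) (Y : T -> 'cV[R]_p) (s : R).
Hypothesis mY : forall k, measurable_fun [set: T] (fun x => Y x k 0).
Hypothesis s0 : 0 < s.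
Hypothesis Ysg : subgaussian_vec mu Y s.

Definition second_moment : 'M[R]_p :=
  \matrix_(k, l) \int[mu]_x (Y x k 0 * Y x l 0).

Definition dotp (v w : 'cV[R]_p) : R := (v^T *m w) 0 0.

Lemma dotpE v w : dotp v w = \sum_k v k 0 * w k 0.
Proof. by rewrite /dotp mxE; apply: eq_bigr => k _; rewrite mxE. Qed.

Lemma dotp_delta k w : dotp (delta_mx k 0) w = w k 0.
Proof. by rewrite /dotp trmx_delta -rowE mxE. Qed.

Lemma sqn_delta k : sqn (delta_mx k 0 : 'cV[R]_p) = 1.
Proof. by rewrite sqnE [LHS]dotp_delta mxE !eqxx. Qed.

Lemma measurable_dotp v : measurable_fun [set: T] (fun x => dotp v (Y x)).
Proof.
rewrite (_ : (fun x => _) = fun x => \sum_k v k 0 * Y x k 0).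
  by apply: measurable_sum => k; apply: measurable_funM.
by apply/funext => x; rewrite dotpE.
Qed.

Let W (v : 'cV[R]_p) x : R := expR ((dotp v (Y x) / s) ^+ 2).

Let W_mean v : sqn v = 1 -> intg (W v) /\ \int[mu]_x W v x <= 2.
Proof.
move=> v1; have mW : measurable_fun [set: T] (W v).
  apply: measurableT_comp => //; apply: measurable_funX.
  by apply: measurable_funM => //; exact: measurable_dotp.
have W2 : (\int[mu]_x (W v x)%:E <= 2%:E)%E.
  have := @Ysg v; rewrite l2normE v1 sqrtr1 => /(_ erefl).
  by rewrite unlock.
have W0 : (0 <= \int[mu]_x (W v x)%:E)%E.
  by apply: integral_ge0 => x _; rewrite lee_fin expR_ge0.
split; last first.
  by rewrite -lee_fin fineK// ge0_fin_numE// (le_lt_trans W2)// ltry.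
apply/integrableP; split; first exact/measurable_EFinP.
under eq_integral do rewrite /= ger0_norm ?expR_ge0//.
by rewrite (le_lt_trans W2)// ltry.
Qed.

Let sq_le_W v x : dotp v (Y x) ^+ 2 <= s ^+ 2 * W v x.
Proof.
have := expR_ge1Dx ((dotp v (Y x) / s) ^+ 2); rewrite -/(W v x).
rewrite expr_div_n => h; rewrite mulrC -ler_pdivrMr ?exprn_gt0//; lra.
Qed.

Let quad_le_W v x : dotp v (Y x) ^+ 4 <= 2 * s ^+ 4 * W v x.
Proof.
have := @expR_ge1Dxn R ((dotp v (Y x) / s) ^+ 2) 1 (sqr_ge0 _).
have -> : (2`!)%N = 2%N by [].
rewrite -/(W v x) -exprM expr_div_n (_ : (2 * 2 = 4)%N)// => h.
have -> : 2 * s ^+ 4 * W v x = 2 * W v x * s ^+ 4 by ring.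
rewrite -ler_pdivrMr ?exprn_gt0//; lra.
Qed.

Lemma intg_sq_dotp v : sqn v = 1 -> intg (fun x => dotp v (Y x) ^+ 2).
Proof.
move=> v1; apply: (@intg_le _ (fun x => \sum_(i < 1) s ^+ 2 * W v x)).
- by apply: measurable_funX; exact: measurable_dotp.
- by move=> x; rewrite big_ord1 ger0_norm ?sqr_ge0// sq_le_W.
- by apply: intg_lin => _; case: (W_mean v1).
Qed.

Lemma intg_coord_prod k l : intg (fun x => Y x k 0 * Y x l 0).
Proof.
pose c (b : bool) : R := 1.
pose f (b : bool) x := dotp (delta_mx (if b then k else l) 0) (Y x) ^+ 2.
apply: (@intg_le _ (fun x => \sum_b c b * f b x)).
- by apply: measurable_funM.
- move=> x; rewrite big_bool /c /f /= !mul1r !dotp_delta normrM.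
  rewrite -[in leRHS](real_normK (num_real (Y x k 0))).
  rewrite -[in leRHS](real_normK (num_real (Y x l 0))).
  have := sqr_ge0 (`|Y x k 0| - `|Y x l 0|).
  have := normr_ge0 (Y x k 0); have := normr_ge0 (Y x l 0); nra.
- by apply: intg_lin => b; apply: intg_sq_dotp; exact: sqn_delta.
Qed.

Lemma qform_second_moment v :
  qform second_moment v = \int[mu]_x (dotp v (Y x) ^+ 2).
Proof.
rewrite (_ : (fun x => _) = fun x =>
  \sum_(kl : 'I_p * 'I_p) (v kl.1 0 * v kl.2 0) * (Y x kl.1 0 * Y x kl.2 0)).
  rewrite Rintegral_lin; last by move=> [k l]; exact: intg_coord_prod.
  rewrite qformE (pair_bigA _ (fun k l => second_moment k l * (v k 0 * v l 0))).
  by apply: eq_bigr => -[k l] _; rewrite mxE mulrC.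
apply/funext => x; rewrite dotpE expr2 big_distrlr /= pair_bigA /=.
by apply: eq_bigr => -[k l] _ /=; ring.
Qed.

Lemma second_moment_diag k : second_moment k k <= 2 * s ^+ 2.
Proof.
have [Wi W2] := W_mean (sqn_delta k).
have -> : second_moment k k =
    \int[mu]_x (dotp (delta_mx k 0) (Y x) ^+ 2).
  by rewrite mxE; apply: eq_Rintegral => x _; rewrite dotp_delta expr2.
apply: (@le_trans _ _ (\int[mu]_x (\sum_(i < 1) s ^+ 2 * W (delta_mx k 0) x))).
  apply: le_Rintegral => //; first by apply: intg_sq_dotp; exact: sqn_delta.
    by apply: intg_lin.
  by move=> x _; rewrite big_ord1 sq_le_W.
rewrite Rintegral_lin// big_ord1 mulrC ler_pM2r ?exprn_gt0//.
Qed.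

Definition far_set (t : R) (v : 'cV[R]_p) : set T :=
  [set x | t <= dotp v (Y x) ^+ 2].

Lemma measurable_far_set t v : measurable (far_set t v).
Proof.
rewrite -[far_set t v]setTI.
apply: (@measurable_fun_le _ _ _ _ (cst t)) => //.
by apply: measurable_funX; exact: measurable_dotp.
Qed.

(** Paley-Zygmund: integrate
    [y^2 <= eps / 4 + alpha y^4 + 1{y^2 >= eps / 4} / (4 alpha)], the fourth
    moment of [y = <v, Y>] being at most [4 s^4]. *)
Lemma small_ball (eps : R) v : 0 < eps -> sqn v = 1 ->
  eps <= qform second_moment v ->
  ((eps ^+ 2 / (8 * s ^+ 4))%:E <= mu (far_set (eps / 4) v))%E.
Proof.
move=> eps0 v1 epsM; set B := far_set _ _.
have mB : measurable B by exact: measurable_far_set.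
have [Wi W2] := W_mean v1.
pose alpha := eps / (16 * s ^+ 4).
have s4 : 0 < s ^+ 4 by rewrite exprn_gt0.
have alpha0 : 0 < alpha by rewrite divr_gt0// mulr_gt0.
have alpha40 : 0 < 4 * alpha by rewrite mulr_gt0.
pose c (i : 'I_3) : R := [tuple eps / 4; 2 * alpha * s ^+ 4; (4 * alpha)^-1]`_i.
pose f (i : 'I_3) : T -> R := nth (cst 0) [:: cst 1; W v; \1_B] i.
have fi i : intg (f i).
  case: i => -[|[|[|//]]] i3 /=.
  - exact: finite_measure_integrable_cst.
  - exact: Wi.
  - exact: integrable_indic.
have key : \int[mu]_x (dotp v (Y x) ^+ 2) <= \int[mu]_x (\sum_i c i * f i x).
  apply: le_Rintegral => //; [exact: intg_sq_dotp|exact: intg_lin|].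
  move=> x _; rewrite !big_ord_recl big_ord0 /c /f /= mulr1 addr0.
  have := quad_le_W v x; set y := dotp v (Y x); set w := W v x => h4.
  have y4 : alpha * y ^+ 4 <= 2 * alpha * s ^+ 4 * w by nra.
  have a40 : 0 < (4 * alpha)^-1 by rewrite invr_gt0.
  have a4 : (4 * alpha)^-1 * (4 * alpha) = 1 by rewrite mulVf// gt_eqF.
  have y40 : 0 <= alpha * y ^+ 4 by rewrite (mulr_ge0 (ltW alpha0))// exprn_even_ge0.
  have [xB|xB] := pselect (B x).
    rewrite indicE mem_set// mulr1.
    have := sqr_ge0 (2 * alpha * y ^+ 2 - 1).
    have -> : (2 * alpha * y ^+ 2 - 1) ^+ 2 =
       4 * alpha * (alpha * y ^+ 4 + (4 * alpha)^-1 - y ^+ 2).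
      by rewrite mulrBr mulrDr [_ * _^-1]mulrC a4; ring.
    rewrite pmulr_rge0//; lra.
  rewrite indicE memNset// mulr0.
  have : y ^+ 2 < eps / 4 by rewrite ltNge; apply/negP.
  lra.
rewrite -qform_second_moment Rintegral_lin// in key.
move: key; rewrite !big_ord_recl big_ord0 addr0 /c /f /=.
have -> : \int[mu]_(_ in [set: T]) 1 = 1.
  by rewrite Rintegral_cst// [X in fine X](@probability_setT _ _ _ mu) mulr1.
rewrite mulr1.
have -> : \int[mu]_x \1_B x = fine (mu B).
  by rewrite /Rintegral integral_indic// setIT.
rewrite -[X in _ -> (_ <= X)%E]fineK ?fin_num_measure// lee_fin.
set b := fine (mu B) => key.
have e4 : 2 * alpha * s ^+ 4 = eps / 8.
  by rewrite /alpha; field; rewrite gt_eqF.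
rewrite e4 in key.
have eW : eps / 8 * \int[mu]_x W v x <= eps / 8 * 2.
  by rewrite ler_wpM2l// divr_ge0// ltW.
have h1 : eps / 2 <= (4 * alpha)^-1 * b by lra.
have -> : eps ^+ 2 / (8 * s ^+ 4) = 4 * alpha * (eps / 2).
  by rewrite /alpha; field; rewrite gt_eqF.
by rewrite -ler_pdivlMl.
Qed.

End moments.

(** * The estimator is close to the target on a good data set *)

Section cauchy_schwarz.
Variables (R : realType) (I : finType) (Q : pred I).
Implicit Types f g : I -> R.

Lemma sum_sqr_ge0 f : 0 <= \sum_(i | Q i) f i ^+ 2.
Proof. by apply: sumr_ge0 => i _; exact: sqr_ge0. Qed.

Lemma cauchy_schwarz_sum f g :
  \sum_(i | Q i) f i * g i <=
  Num.sqrt (\sum_(i | Q i) f i ^+ 2) * Num.sqrt (\sum_(i | Q i) g i ^+ 2).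
Proof.
set A := \sum_(i | Q i) f i ^+ 2; set B := \sum_(i | Q i) g i ^+ 2.
set C := \sum_(i | Q i) f i * g i.
have A0 : 0 <= A by exact: sum_sqr_ge0.
have B0 : 0 <= B by exact: sum_sqr_ge0.
have [Bz|Bn] := eqVneq B 0.
  rewrite Bz sqrtr0 mulr0 /C big1// => i Qi.
  have /eqP := Bz; rewrite psumr_eq0 => [/allP/(_ i)|j _]; last exact: sqr_ge0.
  by rewrite mem_index_enum Qi sqrf_eq0 => /(_ isT)/eqP ->; rewrite mulr0.
have Bp : 0 < B by rewrite lt_def Bn.
have : 0 <= \sum_(i | Q i) (B * f i - C * g i) ^+ 2 by exact: sum_sqr_ge0.
have -> : \sum_(i | Q i) (B * f i - C * g i) ^+ 2 = B * (A * B - C ^+ 2).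
  rewrite (eq_bigr (fun i => B ^+ 2 * f i ^+ 2 - 2 * B * C * (f i * g i)
    + C ^+ 2 * g i ^+ 2)) => [|i _]; last by ring.
  by rewrite !big_split /= sumrN -!mulr_sumr -/A -/B -/C; ring.
rewrite pmulr_rge0// subr_ge0 => CAB.
rewrite -sqrtrM// (le_trans (ler_norm _))// -sqrtr_sqr ler_wsqrtr//.
Qed.

Lemma sqrt_sum_sqr_triangle f g :
  Num.sqrt (\sum_(i | Q i) (f i + g i) ^+ 2) <=
  Num.sqrt (\sum_(i | Q i) f i ^+ 2) + Num.sqrt (\sum_(i | Q i) g i ^+ 2).
Proof.
have f0 := sum_sqr_ge0 f; have g0 := sum_sqr_ge0 g.
rewrite -[leRHS]ger0_norm ?addr_ge0 ?sqrtr_ge0// -sqrtr_sqr ler_wsqrtr//.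
rewrite sqrrD !sqr_sqrtr//.
rewrite (eq_bigr (fun i => f i ^+ 2 + 2 * (f i * g i) + g i ^+ 2)) => [|i _].
  by rewrite !big_split -!mulr_sumr /=; have := cauchy_schwarz_sum f g; lra.
by ring.
Qed.

End cauchy_schwarz.

Section selection.
Variables (R : realType) (F : pairwise_family R).
Local Notation d := (nvar F).
Local Notation m := (width F).
Local Notation pdim := (pdim F).
Local Notation theta_t := 'cV[R]_pdim.
Implicit Types (theta Delta : theta_t) (i : 'I_d) (k : 'I_pdim).

(** ** Selection matrices *)

Lemma ordered_pair_inj i : injective (fun j => ordered_pair (F := F) j i).
Proof.
move=> j j'; rewrite /ordered_pair.
by case: leqP => h; case: leqP => h' /eqP; rewrite xpair_eqE -!val_eqE /=;
  move=> /andP[/eqP e1 /eqP e2]; apply: val_inj => /=; lia.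
Qed.

Lemma col_selP i c : exists k0, forall k, col_sel (F := F) i c k = (k == k0)%:R.
Proof.
have Pk : (fun k : 'I_d * 'I_d * 'I_m =>
    (k.1.1 <= k.1.2)%N && (k.2 < gsize k.1.1 k.1.2)%N)
    (ordered_pair (cvertex c) i, ccomp c).
  have := valP (enum_val c); rewrite -/(cvertex c) -/(ccomp c) /ordered_pair /=.
  by case: (leqP (cvertex c) i) => [-> //|/ltnW ij]; rewrite /= ij gsizeC.
pose k0 : pidx F := Sub (ordered_pair (cvertex c) i, ccomp c) Pk.
exists (enum_rank k0) => k; rewrite mxE; congr (nat_of_bool _)%:R.
apply/andP/eqP => [[/eqP e1 /eqP e2]|->]; last first.
  by rewrite /group_of /comp_of enum_rankK.
apply: enum_val_inj; rewrite enum_rankK; apply: val_inj.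
by rewrite /= e1 e2 /group_of /comp_of -surjective_pairing.
Qed.

Lemma col_of_sum (h : R -> R) i c theta :
  h (col_of i theta c 0) = \sum_k col_sel i c k * h (theta k 0).
Proof.
have [k0 k0P] := col_selP c.
have sel (f : 'I_pdim -> R) : \sum_k col_sel i c k * f k = f k0.
  rewrite (bigD1 k0)//= k0P eqxx mul1r big1 ?addr0// => k /negbTE kk0.
  by rewrite k0P kk0 mul0r.
by rewrite sel /col_of mxE sel.
Qed.

(** The parameter of an edge occurs in the columns of both of its ends, that of
    a vertex in one column. *)
Lemma col_sel_count k : 1 <= (\sum_i \sum_c col_sel i c k : R) <= 2.
Proof.
have sel0 i c : 0 <= col_sel i c k by rewrite mxE ler0n.
have /andP[ab u_lt] := valP (enum_val k).
rewrite -/(group_of k) -/(comp_of k) in ab u_lt.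
set a := (group_of k).1 in ab u_lt; set b := (group_of k).2 in ab u_lt.
apply/andP; split.
  pose c0 : cidx b := Sub (a, comp_of k) u_lt.
  rewrite (bigD1 b)//= (bigD1 (enum_rank c0))//= -addrA.
  have -> : col_sel b (enum_rank c0) k = 1 :> R.
    rewrite mxE /cvertex /ccomp enum_rankK /= /ordered_pair ab.
    by rewrite -surjective_pairing !eqxx.
  by rewrite lerDl addr_ge0// sumr_ge0// => i _; rewrite sumr_ge0.
have sum1 (j : 'I_d) : \sum_i (i == j)%:R = 1 :> R.
  by rewrite (bigD1 j)//= eqxx big1 ?addr0// => i /negbTE ->.
apply: (@le_trans _ _ (\sum_i ((i == a)%:R + (i == b)%:R))); last first.
  by rewrite big_split /= !sum1.
apply: ler_sum => i _.
have colP c : col_sel i c k != 0 :> R -> [/\ ordered_pair (cvertex c) i = (a, b),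
    ccomp c = comp_of k & col_sel i c k = 1 :> R].
  rewrite mxE; case: andP => [[/eqP -> /eqP ->] _|]; last by rewrite eqxx.
  by rewrite -surjective_pairing.
have uniq_c c c' : col_sel i c k != 0 :> R -> col_sel i c' k != 0 :> R -> c = c'.
  move=> /colP[e1 e2 _] /colP[e1' e2' _].
  apply: enum_val_inj; apply: val_inj.
  rewrite [LHS]surjective_pairing [RHS]surjective_pairing.
  rewrite -/(cvertex c) -/(cvertex c') -/(ccomp c) -/(ccomp c') e2 e2'.
  by rewrite (ordered_pair_inj (etrans e1 (esym e1'))).
have [c cP|no_c] := pickP (fun c => col_sel i c k != 0 :> R); last first.
  by rewrite big1 ?addr_ge0 ?ler0n// => c _; apply/eqP/negbFE/no_c.
rewrite (bigD1 c)//= big1 ?addr0 => [|c' cc']; last first.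
  by apply: contraNeq cc' => h; rewrite (uniq_c _ _ h cP).
have [ei _ ->] := colP _ cP.
have : (i == a) || (i == b).
  move: ei => /eqP; rewrite /ordered_pair.
  by case: leqP => _; rewrite xpair_eqE => /andP[h1 h2]; rewrite ?h1 ?h2 ?orbT.
by case/orP => ->; rewrite ?lerDl ?lerDr ler0n.
Qed.

End selection.

Section family_matrices.
Variables (R : realType) (F : pairwise_family R).
Local Notation d := (nvar F).
Local Notation m := (width F).
Local Notation pdim := (pdim F).
Local Notation pairs := ('I_d * 'I_d)%type.
Implicit Types (theta Delta g : 'cV[R]_pdim) (i : 'I_d) (k : 'I_pdim).
Implicit Types (p : pairs) (S : {set pairs}).

(** The common shape of [Gamma_hat] and [Gamma_star], through which entrywise
    deviations and lower bounds of the [d] blocks pass to the whole matrix. *)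
Definition assemble (M : forall i, 'M[R]_(cdim i)) : 'M[R]_pdim :=
  \sum_i (col_sel i)^T *m M i *m col_sel i.

Lemma qform_assemble M theta :
  qform (assemble M) theta = \sum_i qform (M i) (col_of i theta).
Proof.
rewrite /qform /assemble mulmx_sumr mulmx_suml summxE.
by apply: eq_bigr => i _; rewrite /col_of trmx_mul !mulmxA.
Qed.

Lemma assembleB M N : assemble (fun i => M i - N i) = assemble M - assemble N.
Proof.
by rewrite /assemble -sumrB; apply: eq_bigr => i _; rewrite mulmxBr mulmxBl.
Qed.

Lemma tr_assemble M : (forall i, (M i)^T = M i) -> (assemble M)^T = assemble M.
Proof.
move=> Msym; rewrite /assemble raddf_sum; apply: eq_bigr => i _ /=.
by rewrite !trmx_mul trmxK Msym !mulmxA.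
Qed.

Lemma sqn_le_sum_col_of theta : sqn theta <= \sum_i sqn (col_of i theta).
Proof.
pose sq (x : R) := x ^+ 2.
have -> : \sum_i sqn (col_of i theta) =
    \sum_k (\sum_i \sum_c col_sel i c k) * theta k 0 ^+ 2.
  under eq_bigr => i _.
    rewrite /sqn (eq_bigr _ (fun c _ => col_of_sum sq c theta)).
    rewrite exchange_big /=; over.
  rewrite exchange_big /=; apply: eq_bigr => k _; rewrite mulr_suml.
  by apply: eq_bigr => i _; rewrite mulr_suml.
apply: ler_sum => k _; have /andP[h _] := col_sel_count k.
by rewrite ler_peMl// sqr_ge0.
Qed.

Lemma assemble_qform_lower M (e : R) theta : 0 <= e ->
  (forall i v, e * sqn v <= qform (M i) v) ->
  e * sqn theta <= qform (assemble M) theta.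
Proof.
move=> e0 eM; rewrite qform_assemble.
rewrite (le_trans (ler_wpM2l e0 (sqn_le_sum_col_of theta)))// mulr_sumr.
exact: ler_sum.
Qed.

Lemma col_of_l1_le_kappa1 i theta :
  \sum_c `|col_of i theta c 0| <= kappa1 theta.
Proof. exact: (le_bigmax _ (fun i => \sum_c `|col_of i theta c 0|)). Qed.

Lemma kappa1_ge0 theta : 0 <= kappa1 theta.
Proof. exact: bigmax_ge_id. Qed.

(** Every row of the assembled matrix meets at most two columns of [theta],
    whose [l^1]-norms are at most [kappa1 theta]. *)
Lemma assemble_entry_le (M : forall i, 'M[R]_(cdim i)) (t : R) theta k : 0 <= t ->
  (forall i c c', `|M i c c'| <= t) ->
  `|(assemble M *m theta) k 0| <= 2 * t * kappa1 theta.
Proof.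
move=> t0 Mt.
have -> : (assemble M *m theta) k 0 =
    \sum_i \sum_c col_sel i c k * (M i *m col_of i theta) c 0.
  rewrite /assemble mulmx_suml summxE; apply: eq_bigr => i _.
  by rewrite -!mulmxA mxE; apply: eq_bigr => c _; rewrite mxE.
have inner i c : `|(M i *m col_of i theta) c 0| <= t * kappa1 theta.
  rewrite mxE (le_trans (ler_norm_sum _ _ _))//.
  rewrite (le_trans _ (ler_wpM2l t0 (col_of_l1_le_kappa1 i theta)))// mulr_sumr.
  by apply: ler_sum => c' _; rewrite normrM ler_wpM2r.
have /andP[_ h2] := col_sel_count k.
rewrite -mulrA (le_trans _ (ler_wpM2r _ h2)) ?mulr_ge0 ?kappa1_ge0//.
rewrite mulr_suml (le_trans (ler_norm_sum _ _ _))//; apply: ler_sum => i _.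
rewrite mulr_suml (le_trans (ler_norm_sum _ _ _))//; apply: ler_sum => c _.
have c0 : 0 <= col_sel i c k :> R by rewrite mxE ler0n.
by rewrite normrM ger0_norm// ler_wpM2l.
Qed.

Lemma Gamma_hat_assemble (n : nat) (x : 'I_n -> 'rV[R]_d) :
  Gamma_hat x = assemble (Gammai_hat x).
Proof.
rewrite /Gamma_hat /assemble /Gammai_hat /A_mx exchange_big /= scaler_sumr.
apply: eq_bigr => i _.
by rewrite -scalemxAr -scalemxAl mulmx_sumr mulmx_suml.
Qed.

Lemma tr_Gammai_hat (n : nat) (x : 'I_n -> 'rV[R]_d) i :
  (Gammai_hat x i)^T = Gammai_hat x i.
Proof.
rewrite /Gammai_hat linearZ /= raddf_sum; congr (_ *: _).
by apply: eq_bigr => r _ /=; rewrite trmx_mul trmxK.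
Qed.

(** ** The penalty *)

Lemma group_norm_ge0 p theta : 0 <= group_norm p theta.
Proof. exact: sqrtr_ge0. Qed.

Lemma group_norm_triangle p theta Delta :
  group_norm p (theta + Delta) <= group_norm p theta + group_norm p Delta.
Proof.
rewrite /group_norm (eq_bigr (fun k => (theta k 0 + Delta k 0) ^+ 2)).
  exact: sqrt_sum_sqr_triangle.
by move=> k _; rewrite mxE.
Qed.

Lemma group_normN p theta : group_norm p (- theta) = group_norm p theta.
Proof.
by rewrite /group_norm; congr Num.sqrt; apply: eq_bigr => k _; rewrite mxE sqrrN.
Qed.

Lemma card_group_le p : (#|[pred k : 'I_pdim | group_of k == p]| <= m)%N.
Proof.
rewrite -[leqRHS]card_ord -(card_in_image (f := @comp_of R F)).
  exact: max_card.
move=> k k' /eqP ek /eqP ek' ec; apply: enum_val_inj; apply: val_inj.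
rewrite [LHS]surjective_pairing [RHS]surjective_pairing.
by rewrite -/(group_of k) -/(group_of k') -/(comp_of k) -/(comp_of k') ek ek' ec.
Qed.

Lemma group_norm_le p g (s : R) : 0 <= s -> (forall k, `|g k 0| <= s) ->
  group_norm p g <= Num.sqrt m%:R * s.
Proof.
move=> s0 gs; rewrite -[s in leRHS]ger0_norm// -sqrtr_sqr -sqrtrM ?ler0n//.
rewrite ler_wsqrtr//.
apply: (@le_trans _ _ (\sum_(k | group_of k == p) s ^+ 2)).
  apply: ler_sum => k _; rewrite -(real_normK (num_real (g k 0))).
  by rewrite lerXn2r// nnegrE.
by rewrite sumr_const -[leLHS]mulr_natl ler_wpM2r ?sqr_ge0// ler_nat card_group_le.
Qed.

Lemma group_of_le k : ((group_of k).1 <= (group_of k).2)%N.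
Proof. by have /andP[] := valP (enum_val k). Qed.

Lemma dotp_le_groups g Delta (gamma : R) :
  (forall p, group_norm p g <= gamma) ->
  - dotp g Delta <= gamma * \sum_(p : pairs | (p.1 <= p.2)%N) group_norm p Delta.
Proof.
move=> g_le; rewrite dotpE -sumrN mulr_sumr.
rewrite (partition_big (@group_of R F) (fun p => p.1 <= p.2)%N) /=; last first.
  by move=> k _; exact: group_of_le.
apply: ler_sum => p _.
rewrite (le_trans _ (ler_wpM2r (group_norm_ge0 p Delta) (g_le p)))//.
rewrite -group_normN /group_norm.
under eq_bigr => k _ do rewrite -mulNr.
have := cauchy_schwarz_sum (fun k => group_of k == p) (fun k => (- g) k 0)
   (fun k => Delta k 0).
by rewrite (eq_bigr (fun k => - g k 0 * Delta k 0))// => k _; rewrite mxE.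
Qed.

Lemma sum_group_norm_le S Delta :
  \sum_(p in S | (p.1 <= p.2)%N) group_norm p Delta <=
  Num.sqrt #|S|%:R * l2norm Delta.
Proof.
have := cauchy_schwarz_sum (fun p => (p \in S) && (p.1 <= p.2)%N) (fun=> 1)
  (fun p => group_norm p Delta).
rewrite (eq_bigr (fun p => group_norm p Delta)) => [|p _]; last by rewrite mul1r.
move=> /le_trans; apply; apply: ler_pM; rewrite ?sqrtr_ge0//; apply: ler_wsqrtr.
  rewrite (eq_bigr (fun=> 1)) => [|p _]; last by rewrite expr1n.
  rewrite sumr_const ler_nat; apply: subset_leq_card; apply/fintype.subsetP => p.
  by case/andP.
rewrite (partition_big (@group_of R F) (fun p => p.1 <= p.2)%N (P := xpredT)) /=; last first.
  by move=> k _; exact: group_of_le.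
rewrite [leRHS](bigID (mem S)) /= -[leLHS]addr0 lerD//; last first.
  by apply: sumr_ge0 => p _; apply: sumr_ge0 => k _; exact: sqr_ge0.
rewrite [leRHS](eq_bigl (fun p => (p \in S) && (p.1 <= p.2)%N)); last first.
  by move=> p; rewrite andbC.
apply: ler_sum => p _; rewrite sqr_sqrtr//; exact: sum_sqr_ge0.
Qed.

(** ** The basic inequality *)

Lemma objective_diff (n : nat) (x : 'I_n -> 'rV[R]_d) (lambda : R) theta Delta :
  objective x lambda (theta + Delta) - objective x lambda theta =
  2^-1 * qform (Gamma_hat x) Delta + dotp (Gamma_hat x *m theta + K_hat x) Delta
  + lambda * (penalty (theta + Delta) - penalty theta).
Proof.
have sym : (Gamma_hat x)^T = Gamma_hat x.
  by rewrite Gamma_hat_assemble tr_assemble//; exact: tr_Gammai_hat.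
rewrite /objective /dotp /qform; set G := Gamma_hat x; set K := K_hat x.
have -> : (theta + Delta)^T = theta^T + Delta^T by rewrite linearD.
have -> : (G *m theta + K)^T = theta^T *m G + K^T.
  by rewrite linearD /= trmx_mul sym.
rewrite !mulmxDl !mulmxDr.
have -> : Delta^T *m G *m theta = (theta^T *m G *m Delta)^T.
  by rewrite !trmx_mul trmxK sym mulmxA.
move: (theta^T *m G *m theta) (theta^T *m G *m Delta) (Delta^T *m G *m Delta).
move: (K^T *m theta) (K^T *m Delta) => m1 m2 m3 m4 m5.
by rewrite !mxE; field.
Qed.

(** Comparing the objective at the solution and at [theta] leaves the noise
    [<g, Delta>] and the change of the penalty, which outside the support [S] of
    [theta] equals [- lambda |Delta_p|]. When [gamma <= lambda] this absorbs the
    noise outside [S]; when [S] contains every group nothing has to be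
    absorbed. *)
Lemma oracle_inequality (n : nat) (x : 'I_n -> 'rV[R]_d) (rho gamma lambda : R)
    theta th S : 0 < rho -> 0 <= gamma -> 0 <= lambda ->
  (forall v, rho * sqn v <= qform (Gamma_hat x) v) ->
  (forall p, group_norm p (Gamma_hat x *m theta + K_hat x) <= gamma) ->
  (forall k, group_of k \notin S -> theta k 0 = 0) ->
  gamma <= lambda \/ (forall p, p \in S) ->
  rsm_solutions x lambda th ->
  l2norm (th - theta) <= 2 * (gamma + lambda) * Num.sqrt #|S|%:R / rho.
Proof.
move=> rho0 gamma0 lambda0 Gx noise supp absorb sol.
set Delta := th - theta.
have basic : rho / 2 * sqn Delta <=
    (gamma + lambda) * \sum_(p in S | (p.1 <= p.2)%N) group_norm p Delta.
  have := sol theta; rewrite -subr_le0.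
  have -> : th = theta + Delta by rewrite /Delta addrC subrK.
  rewrite objective_diff => opt.
  have := dotp_le_groups Delta noise; have := Gx Delta.
  have : penalty theta - penalty (theta + Delta) <=
      \sum_(p in S | (p.1 <= p.2)%N) group_norm p Delta -
      \sum_(p | (p \notin S) && (p.1 <= p.2)%N) group_norm p Delta.
    have inS p : group_norm p theta - group_norm p (theta + Delta) <=
        group_norm p Delta.
      have := group_norm_triangle p (theta + Delta) (- Delta).
      by rewrite addrK group_normN; lra.
    have offS p : p \notin S -> group_norm p theta - group_norm p (theta + Delta)
        = - group_norm p Delta.
      move=> pS; have th0 k : group_of k == p -> theta k 0 = 0.
        by move=> /eqP kp; apply: supp; rewrite kp.
      have -> : group_norm p theta = 0.
        by rewrite /group_norm big1 ?sqrtr0// => k /th0 ->; rewrite expr0n.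
      rewrite sub0r /group_norm; congr (- Num.sqrt _).
      by apply: eq_bigr => k /th0 thk; rewrite mxE thk add0r.
    rewrite /penalty -sumrB (bigID (mem S)) /=.
    under eq_bigl do rewrite andbC.
    under [X in _ + X <= _]eq_bigl do rewrite andbC.
    rewrite -[X in _ <= _ + X]sumrN lerD//.
      by apply: ler_sum => p _; exact: inS.
    by apply: ler_sum => p /andP[pS _]; rewrite offS.
  have -> : \sum_(p : pairs | (p.1 <= p.2)%N) group_norm p Delta =
      \sum_(p in S | (p.1 <= p.2)%N) group_norm p Delta +
      \sum_(p | (p \notin S) && (p.1 <= p.2)%N) group_norm p Delta.
    by rewrite (bigID (mem S)) /=; congr (_ + _); apply: eq_bigl => p; rewrite andbC.
  set sS := \sum_(p in S | _) _; set sN := \sum_(p | _) _ => hpen hG hnoise.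
  have sN0 : 0 <= sN by apply: sumr_ge0 => p _; exact: group_norm_ge0.
  have absorb' : gamma * sN <= lambda * sN.
    case: absorb => [gl|allS]; first by rewrite ler_wpM2r.
    by rewrite /sN big1 ?mulr0// => p; rewrite allS.
  have : lambda * (penalty theta - penalty (theta + Delta)) <= lambda * (sS - sN).
    by rewrite ler_wpM2l.
  lra.
have [D0|Dn] := eqVneq (l2norm Delta) 0.
  by rewrite D0 divr_ge0 ?(ltW rho0)// !mulr_ge0 ?addr_ge0 ?sqrtr_ge0.
have D0 : 0 < l2norm Delta by rewrite lt_def Dn sqrtr_ge0.
rewrite ler_pdivlMr// -(ler_pM2r D0).
have : (gamma + lambda) * \sum_(p in S | (p.1 <= p.2)%N) group_norm p Delta <=
    (gamma + lambda) * (Num.sqrt #|S|%:R * l2norm Delta).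
  by rewrite ler_wpM2l ?addr_ge0// sum_group_norm_le.
have : l2norm Delta ^+ 2 = sqn Delta by rewrite sqr_sqrtr// sqn_ge0.
nra.
Qed.

End family_matrices.

(** * Population matrices *)

Lemma posdef_unitmx (R : realType) (p : nat) (A : 'M[R]_p) (e : R) : 0 < e ->
  (forall v, e * sqn v <= qform A v) -> A \in unitmx.
Proof.
move=> e0 eA; rewrite -row_free_unit -kermx_eq0; apply/rowV0P => u /sub_kermxP uA.
apply: trmx_inj; rewrite trmx0; apply: sqn_eq0; apply/eqP.
rewrite eq_le sqn_ge0 andbT -(pmulr_rle0 _ e0) (le_trans (eA _))//.
by rewrite /qform trmxK uA mul0mx mxE.
Qed.

Lemma continuous_measurable_borel_rV (R : realType) (d : nat)
    (f : 'rV[R]_d -> R) : continuous f ->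
  measurable_fun [set: borel_rV R d] (f : borel_rV R d -> R).
Proof.
move=> /continuousP cf; apply: (measurability _ (RGenOpens.measurableE R)).
move=> _ [_ [a [b ->] <-]]; rewrite setTI; apply: sub_sigma_algebra.
exact/cf/interval_open.
Qed.

Section population.
Variables (R : realType) (F : pairwise_family R).
Local Notation d := (nvar F).
Local Notation m := (width F).
Variable pstar : probability (borel_rV R d) R.

Definition a_rv (i : 'I_d) : borel_rV R d -> 'cV[R]_(cdim i) := a_vec i.

Lemma measurable_a_rv i c : measurable_fun [set: borel_rV R d]
  (fun x => a_rv i x c 0).
Proof.
rewrite (_ : (fun x => _) =
    (partial i (phi (cvertex c) i (ccomp c)) : borel_rV R d -> R)).
  apply: continuous_measurable_borel_rV => x.
  have [_ df] := phi_diff2 (cvertex c) i (ccomp c).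
  exact: differentiable_continuous.
by apply/funext => x; rewrite /a_rv mxE.
Qed.

Lemma Gammai_starE i : Gammai_star pstar i = second_moment pstar (a_rv i).
Proof.
apply/matrixP => k l; rewrite !mxE fine_expectation.
by apply: eq_Rintegral => x _; rewrite mxE big_ord1 [in X in _ * X]mxE.
Qed.

Variable sg : R.
Hypothesis sg0 : 0 < sg.
Hypothesis a_sg : forall i, subgaussian_vec pstar (a_rv i) sg.

Lemma Gamma_star_assemble : Gamma_star pstar = assemble (Gammai_star pstar).
Proof.
apply/matrixP => k l; rewrite mxE fine_expectation /assemble summxE.
pose f i x : R := \sum_(cc : 'I_(cdim i) * 'I_(cdim i))
  (col_sel i cc.1 k * col_sel i cc.2 l) * (a_rv i x cc.1 0 * a_rv i x cc.2 0).
have fi i : pstar.-integrable [set: borel_rV R d] (EFin \o f i).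
  apply: intg_lin => cc.
  exact: intg_coord_prod (@measurable_a_rv i) sg0 (@a_sg i) _ _.
have sandwich (M : forall i, 'M[R]_(cdim i)) i :
    ((col_sel i)^T *m M i *m col_sel i) k l = \sum_cc
      (col_sel i cc.1 k * col_sel i cc.2 l) * M i cc.1 cc.2.
  rewrite mxE -(pair_bigA _ (fun c c' => col_sel i c k * col_sel i c' l * M i c c')).
  rewrite exchange_big; apply: eq_bigr => c' _; rewrite mxE mulr_suml.
  by apply: eq_bigr => c _; rewrite mxE; ring.
transitivity (\int[pstar]_x \sum_i 1 * f i x).
  apply: eq_Rintegral => x _; rewrite /A_mx summxE; apply: eq_bigr => i _.
  rewrite (sandwich (fun i => a_vec i x *m (a_vec i x)^T)) mul1r.
  apply: eq_bigr => cc _; congr (_ * _).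
  by rewrite mxE big_ord1 [in X in _ * X]mxE.
rewrite Rintegral_lin//; apply: eq_bigr => i _; rewrite mul1r.
rewrite sandwich Rintegral_lin => [|cc]; last first.
  exact: intg_coord_prod (@measurable_a_rv i) sg0 (@a_sg i) _ _.
by apply: eq_bigr => cc _; congr (_ * _); rewrite Gammai_starE mxE.
Qed.

Variable eps : R.
Hypothesis eps0 : 0 < eps.
Hypothesis Gammai_lo : forall i, eps <= Lambda_min (Gammai_star pstar i).

Lemma Gammai_star_qform i v : eps * sqn v <= qform (Gammai_star pstar i) v.
Proof.
apply: Lambda_min_qform => //; apply/matrixP => k l.
by rewrite Gammai_starE !mxE; apply: eq_Rintegral => x _; rewrite mulrC.
Qed.

(** The target is the stationary point of the population loss; the lower bounds
    on the blocks make [Gamma_star] invertible. *)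
Lemma Gamma_star_theta_star : Gamma_star pstar *m theta_star pstar = - K_star pstar.
Proof.
rewrite /theta_star mulmxN mulKVmx// (@posdef_unitmx _ _ _ eps)// => v.
rewrite Gamma_star_assemble; apply: assemble_qform_lower => [|i u].
  exact: ltW.
exact: Gammai_star_qform.
Qed.

End population.

(** * Good data sets have high probability *)

Lemma expRN_le_inv (R : realType) (y : R) : 0 < y -> expR (- y) <= y^-1.
Proof.
move=> y0; rewrite expRN lef_pV2 ?posrE ?expR_gt0//.
by have := expR_ge1Dx y; lra.
Qed.

Lemma expRN_le_sqr_inv (R : realType) (y : R) : 0 < y ->
  expR (- y) <= 2 / y ^+ 2.
Proof.
move=> y0; have -> : 2 / y ^+ 2 = (y ^+ 2 / 2)^-1 by rewrite invf_div.
rewrite expRN lef_pV2 ?posrE ?expR_gt0 ?divr_gt0 ?exprn_gt0//.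
have := @expR_ge1Dxn R y 1 (ltW y0).
by have -> : (2`!)%N = 2%N by []; lra.
Qed.

Section events.
Variables (R : realType) (F : pairwise_family R).
Local Notation d := (nvar F).
Local Notation m := (width F).
Variable pstar : probability (borel_rV R d) R.
Variables (disp : measure_display) (Omega : measurableType disp).
Variables (P : probability Omega R) (n : nat).
Variable X : 'I_n -> {mfun Omega >-> borel_rV R d}.
Let data (w : Omega) (r : 'I_n) : 'rV[R]_d := X r w.
Local Notation thetas := (theta_star pstar).

Variables eps sg nu : R.
Hypothesis eps0 : 0 < eps.
Hypothesis sg0 : 0 < sg.
Hypothesis n0 : (0 < n)%N.
Hypothesis iidX : iid_sample P pstar X.
Hypothesis KI : forall k, pstar.-integrable [set: borel_rV R d]
  (fun x => (K_vec (F := F) x k 0)%:E).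
Hypothesis Gammai_lo : forall i, eps <= Lambda_min (Gammai_star pstar i).
Hypothesis data_sg : forall i r, subgaussian_vec P (fun w => a_vec i (data w r)) sg.

(** The tail condition is about the observations, the moments that are needed
    are those of their common law. *)
Lemma subgaussian_pstar i : subgaussian_vec pstar (a_rv i) sg.
Proof.
move=> v v1; have := @data_sg i (Ordinal n0) v v1; apply: le_trans.
rewrite unlock.
pose f x := (expR ((dotp v (a_rv i x) / sg) ^+ 2))%:E.
have mf : measurable_fun [set: borel_rV R d] f.
  apply/measurable_EFinP; apply: measurableT_comp => //; apply: measurable_funX.
  apply: measurable_funM => //; apply: measurable_dotp => k.
  exact: measurable_a_rv.
have f0 x : (0 <= f x)%E by rewrite lee_fin expR_ge0.
have := ge0_integral_distribution (P := P) (X (Ordinal n0)) mf f0.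
rewrite (eq_measure_integral pstar) => [->//|B mB _]; exact: (iidX.1 _ _ mB).
Qed.

Definition K_dev (t : R) k : set Omega :=
  [set w | t <= `|K_hat (data w) k 0 - K_star pstar k 0|].

Definition Gammai_dev (t : R) i k l : set Omega :=
  [set w | t <= `|Gammai_hat (data w) i k l - Gammai_star pstar i k l|].

Definition noise_event (t : R) : set Omega :=
  \big[setU/set0]_k K_dev t k `|`
  \big[setU/set0]_i \big[setU/set0]_(kl : 'I_(cdim i) * 'I_(cdim i))
     Gammai_dev t kl.1 kl.2.

Lemma measurable_a_data i r k : measurable_fun [set: Omega]
  (fun w => a_vec i (data w r) k 0).
Proof.
apply: (@measurableT_comp _ _ _ _ _ _ (fun x => a_rv i x k 0)) => //.
exact: measurable_a_rv.
Qed.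

Let measurable_dev (t b : R) (f : Omega -> R) : measurable_fun [set: Omega] f ->
  measurable [set w | t <= `|f w - b|].
Proof.
move=> mf; rewrite -[X in measurable X]setTI.
apply: (@measurable_fun_le _ _ _ _ (cst t) (fun w => `|f w - b|)) => //.
by apply: measurableT_comp => //; apply: measurable_funB.
Qed.

Lemma measurable_K_dev t k : measurable (K_dev t k).
Proof.
apply: measurable_dev; rewrite (_ : (fun w => _) =
    fun w => n%:R^-1 * \sum_(r < n) K_vec (F := F) (data w r) k 0).
  apply: measurable_funM => //; apply: measurable_sum => r.
  apply: (@measurableT_comp _ _ _ _ _ _
    (fun x : borel_rV R d => K_vec (F := F) x k 0)) => //.
  by apply/measurable_EFinP; have /integrableP[] := KI k.
by apply/funext => w; rewrite mxE summxE.
Qed.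

Lemma measurable_Gammai_dev t i (k l : 'I_(cdim i)) :
  measurable (Gammai_dev t k l).
Proof.
apply: measurable_dev; rewrite (_ : (fun w => _) =
    fun w => n%:R^-1 * \sum_(r < n) a_vec i (data w r) k 0 * a_vec i (data w r) l 0).
  apply: measurable_funM => //; apply: measurable_sum => r.
  by apply: measurable_funM; exact: measurable_a_data.
apply/funext => w; rewrite mxE summxE; congr (_ * _); apply: eq_bigr => r _.
by rewrite mxE big_ord1 [in X in _ * X]mxE.
Qed.

Lemma measurable_noise_event t : measurable (noise_event t).
Proof.
apply: measurableU.
  by apply: bigsetU_measurable => k _; exact: measurable_K_dev.
apply: bigsetU_measurable => i _.
by apply: bigsetU_measurable => cc _; exact: measurable_Gammai_dev.
Qed.

Lemma cdim_le i : (@cdim R F i <= m * d)%N.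
Proof.
rewrite /cdim card_sub (leq_trans (max_card _))// card_prod !card_ord mulnC//.
Qed.

Lemma pdim_le : (pdim F <= (m * d) ^ 3)%N.
Proof.
rewrite /pdim card_sub (leq_trans (max_card _))// !card_prod !card_ord.
have [->|d0] := posnP d; first by rewrite mul0n.
have [->|m0] := posnP m; first by rewrite muln0.
apply: (@leq_trans ((m * d) ^ 2)); last by rewrite leq_pexp2l// muln_gt0 m0.
by rewrite -mulnn -mulnA [(d * m)%N]mulnC leq_mul2r leq_pmull ?orbT.
Qed.

Lemma noise_event_le t (e : R) : 0 <= e ->
  (forall k, (P (K_dev t k) <= e%:E)%E) ->
  (forall i (k l : 'I_(cdim i)), (P (Gammai_dev t k l) <= e%:E)%E) ->
  (P (noise_event t) <= (2 * (m * d)%:R ^+ 3 * e)%:E)%E.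
Proof.
move=> e_ge0 Ke Ge.
rewrite (le_trans (measureU2 P _ _))//.
- by apply: bigsetU_measurable => k _; exact: measurable_K_dev.
- apply: bigsetU_measurable => i _; apply: bigsetU_measurable => cc _.
  exact: measurable_Gammai_dev.
rewrite -mulrA mulr_natl mulr2n EFinD leeD//.
  rewrite (le_trans (prob_bigsetU_le_const (c := e) e_ge0 _ _))//.
    by move=> k; exact: measurable_K_dev.
  by rewrite lee_fin ler_wpM2r// -natrX ler_nat card_ord pdim_le.
apply: (@le_trans _ _ ((#|'I_d|%:R * ((m * d)%:R ^+ 2 * e))%:E)).
  apply: prob_bigsetU_le_const => [|i|i _].
  - by rewrite mulr_ge0.
  - by apply: bigsetU_measurable => cc _; exact: measurable_Gammai_dev.
  rewrite (le_trans (prob_bigsetU_le_const (c := e) e_ge0 _ _))//.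
    by move=> cc; exact: measurable_Gammai_dev.
  rewrite lee_fin ler_wpM2r// -natrX ler_nat card_prod card_ord.
  by rewrite -mulnn leq_mul// cdim_le.
rewrite lee_fin card_ord mulrA ler_wpM2r// -!natrX -natrM ler_nat.
rewrite [leqRHS]expnS leq_mul2r expn_eq0 muln_eq0 andbT.
by case: (posnP m) => [->//|m0]; rewrite leq_pmull ?orbT.
Qed.

(** By [Gamma_star_theta_star] the gradient at the target consists of deviations
    from expectations only. *)
Lemma noise_group_norm_le t w p : 0 <= t -> ~ noise_event t w ->
  group_norm p (Gamma_hat (data w) *m thetas + K_hat (data w)) <=
  Num.sqrt m%:R * (t + 2 * t * kappa1 thetas).
Proof.
move=> t0 wN.
have Kt k : `|K_hat (data w) k 0 - K_star pstar k 0| <= t.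
  rewrite leNgt; apply/negP => /ltW h; apply: wN; left; apply/bigsetUP.
  by exists k.
have Gt i k l : `|Gammai_hat (data w) i k l - Gammai_star pstar i k l| <= t.
  rewrite leNgt; apply/negP => /ltW h; apply: wN; right; apply/bigsetUP.
  by exists i => //; apply/bigsetUP; exists (k, l).
apply: group_norm_le => [|k].
  by rewrite addr_ge0// mulr_ge0 ?kappa1_ge0// mulr_ge0.
have -> : Gamma_hat (data w) *m thetas + K_hat (data w) =
    (K_hat (data w) - K_star pstar) +
    assemble (fun i => Gammai_hat (data w) i - Gammai_star pstar i) *m thetas.
  rewrite assembleB -Gamma_hat_assemble.
  rewrite -(Gamma_star_assemble sg0 subgaussian_pstar) mulmxBl.
  rewrite (Gamma_star_theta_star sg0 subgaussian_pstar eps0 Gammai_lo) opprK.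
  by rewrite addrA addrAC subrK addrC.
rewrite mxE (le_trans (ler_normD _ _))// lerD//.
  by rewrite [X in `|X|]mxE [X in _ + X]mxE Kt.
apply: assemble_entry_le => // i c1 c2.
by rewrite [X in `|X|]mxE [X in _ + X]mxE Gt.
Qed.

(** Sub-Gaussian second moments bound the diagonal of [Gammai_star], and outside
    the noise event the empirical diagonal is within [t] of it. *)
Lemma trace_Gammai_hat_le t w i : ~ noise_event t w ->
  \tr (Gammai_hat (data w) i) <= (cdim i)%:R * (2 * sg ^+ 2 + t).
Proof.
move=> wN.
have -> : (cdim i)%:R * (2 * sg ^+ 2 + t) = \sum_(k < cdim i) (2 * sg ^+ 2 + t).
  by rewrite sumr_const card_ord mulr_natl.
apply: ler_sum => k _.
have h1 : Gammai_star pstar i k k <= 2 * sg ^+ 2.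
  rewrite Gammai_starE; apply: (second_moment_diag _ sg0 (@subgaussian_pstar i)).
  exact: measurable_a_rv.
have : `|Gammai_hat (data w) i k k - Gammai_star pstar i k k| <= t.
  rewrite leNgt; apply/negP => /ltW h; apply: wN; right; apply/bigsetUP.
  by exists i => //; apply/bigsetUP; exists (k, k).
by rewrite ler_norml => /andP[_]; lra.
Qed.

Lemma qform_Gammai_hat w i v :
  qform (Gammai_hat (data w) i) v =
  n%:R^-1 * \sum_(r < n) dotp v (a_rv i (X r w)) ^+ 2.
Proof.
rewrite /qform /Gammai_hat -scalemxAr -scalemxAl mxE; congr (_ * _).
rewrite mulmx_sumr mulmx_suml summxE; apply: eq_bigr => r _.
rewrite /dotp /a_rv; set y := v^T *m _.
have -> : v^T *m (a_vec i (data w r) *m (a_vec i (data w r))^T) *m v = y *m y^T.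
  by rewrite /y trmx_mul trmxK !mulmxA.
by rewrite mxE big_ord1 [in X in _ * X]mxE -expr2.
Qed.

Lemma Gammai_hat_diag_ge0 w i k : 0 <= Gammai_hat (data w) i k k.
Proof.
rewrite mxE summxE mulr_ge0 ?invr_ge0// sumr_ge0// => r _.
by rewrite mxE big_ord1 [X in _ * X]mxE -expr2 sqr_ge0.
Qed.

Local Notation beta := (eps ^+ 2 / (8 * sg ^+ 4)).

Definition flat_set i (v : 'cV[R]_(cdim i)) : set Omega :=
  few_visits X (far_set (a_rv i) (eps / 4) ((Num.sqrt (sqn v))^-1 *: v))
    (n%:R * beta / 4).

(** Outside this event a fixed proportion of the sample is far from the
    hyperplane orthogonal to any nonzero grid vector, which bounds the empirical
    form from below at all grid vectors. *)
Definition flat_event (D : nat) : set Omega :=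
  \big[setU/set0]_i \big[setU/set0]_(f | (f \in grid (@cdim R F i) D) &&
      (sqn (grid_pt R f) != 0)) flat_set (grid_pt R f).

Let measurable_far (i : 'I_d) v t : measurable (far_set (a_rv i) t v).
Proof. by apply: measurable_far_set => k; exact: measurable_a_rv. Qed.

Lemma measurable_flat_event D : measurable (flat_event D).
Proof.
apply: bigsetU_measurable => i _; apply: bigsetU_measurable => f _.
exact: measurable_few_visits.
Qed.

Lemma flat_event_le D :
  (P (flat_event D) <= (d%:R * (2 ^+ ((D + 2) * (m * d)) *
    expR (- (n%:R * beta / 4))))%:E)%E.
Proof.
rewrite -{1}[d]card_ord; apply: prob_bigsetU_le_const => [|i|i _].
- by rewrite mulr_ge0 ?exprn_ge0 ?expR_ge0.
- by apply: bigsetU_measurable => f _; exact: measurable_few_visits.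
rewrite (le_trans (prob_bigsetU_le_const (c := expR (- (n%:R * beta / 4)))
   (expR_ge0 _) _ _))//.
- by move=> f; exact: measurable_few_visits.
- move=> f /andP[_ fn0]; apply: (few_visits_le iidX) => //.
  apply: (small_ball _ sg0 (@subgaussian_pstar i)) => //.
  + exact: measurable_a_rv.
  + by rewrite sqnZ exprVn sqr_sqrtr ?sqn_ge0// mulVf.
  rewrite -Gammai_starE (le_trans _ (Gammai_star_qform eps0 Gammai_lo _))//.
  by rewrite sqnZ exprVn sqr_sqrtr ?sqn_ge0// mulVf// mulr1.
rewrite lee_fin ler_wpM2r ?expR_ge0//.
apply: (@le_trans _ _ (#|grid (@cdim R F i) D|%:R)).
  rewrite ler_nat subset_leq_card//; apply/fintype.subsetP => f.
  by case/andP.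
rewrite -natrX ler_nat (leq_trans (card_grid R _ _))// leq_pexp2l// leq_mul2l.
by rewrite cdim_le orbT.
Qed.

Lemma flat_event_grid D w i f : ~ flat_event D w -> f \in grid (@cdim R F i) D ->
  beta * eps / 16 * sqn (grid_pt R f) <= qform (Gammai_hat (data w) i) (grid_pt R f).
Proof.
move=> wN fG; set z := grid_pt R f.
have [z0|zn0] := eqVneq (sqn z) 0.
  by rewrite z0 (sqn_eq0 z0) qform0 mulr0.
have zp : 0 < sqn z by rewrite lt_def zn0 sqn_ge0.
have n_gt0 : 0 < n%:R :> R by rewrite ltr0n.
set u := (Num.sqrt (sqn z))^-1 *: z.
set B := far_set (a_rv i) (eps / 4) u.
have many : n%:R * beta / 4 < #|visits X B w|%:R.
  rewrite ltNge; apply/negP => h; apply: wN; apply/bigsetUP; exists i => //.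
  by apply/bigsetUP; exists f => //; rewrite fG.
have -> : z = Num.sqrt (sqn z) *: u.
  by rewrite /u scalerA divff ?scale1r// sqrtr_eq0 -ltNge.
rewrite -/z qformZ sqnZ sqr_sqrtr ?sqn_ge0//.
have -> : sqn u = 1 by rewrite sqnZ exprVn sqr_sqrtr ?sqn_ge0// mulVf.
rewrite mulr1 mulrC ler_pM2l// qform_Gammai_hat.
rewrite ler_pdivlMl//.
apply: (@le_trans _ _ (\sum_(r in visits X B w) eps / 4)).
  rewrite sumr_const -[leRHS]mulr_natl.
  have : n%:R * beta / 4 * (eps / 4) <= #|visits X B w|%:R * (eps / 4).
    by rewrite ler_pM2r ?divr_gt0// ltW.
  apply: le_trans; rewrite le_eqVlt; apply/orP; left; apply/eqP; field.
  by rewrite gt_eqF.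
rewrite [leRHS](bigID (mem (visits X B w))) /= -[leLHS]addr0 lerD//.
  by apply: ler_sum => r; rewrite inE => /asboolP.
by apply: sumr_ge0 => r _; exact: sqr_ge0.
Qed.

(** On a good data set the loss is strongly convex and the noise small. *)
Lemma good_data_error (t lambda rho : R) (K : nat) w th
    (S : {set 'I_d * 'I_d}) :
  0 <= t <= nu -> 0 <= lambda ->
  (4 <= K)%N -> 8 * (2 * sg ^+ 2 + nu) <= beta * eps / 16 * K%:R ->
  rho = beta * eps / 16 / 8 ->
  let gamma := Num.sqrt m%:R * (t + 2 * t * kappa1 thetas) in
  ~ noise_event t w -> ~ flat_event (4 * K) w ->
  (forall k, group_of k \notin S -> thetas k 0 = 0) ->
  gamma <= lambda \/ (forall p, p \in S) ->
  rsm_solutions (data w) lambda th ->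
  l2norm (th - thetas) <= 2 * (gamma + lambda) * Num.sqrt #|S|%:R / rho.
Proof.
move=> /andP[t0 tnu] lambda0 K4 Kbig rhoE gamma noiseN flatN supp absorb sol.
have beta0 : 0 < beta by rewrite divr_gt0 ?exprn_gt0// mulr_gt0// exprn_gt0.
have b0 : 0 < beta * eps / 16 by rewrite divr_gt0// mulr_gt0.
have rho0 : 0 < rho by rewrite rhoE divr_gt0.
have gamma0 : 0 <= gamma.
  by rewrite mulr_ge0 ?sqrtr_ge0// addr_ge0// mulr_ge0 ?kappa1_ge0// mulr_ge0.
apply: (oracle_inequality rho0 gamma0 lambda0 _ _ supp absorb sol) => [v|p].
  rewrite Gamma_hat_assemble rhoE.
  apply: assemble_qform_lower => [|i u]; first by rewrite divr_ge0// ltW.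
  apply: (grid_qform_lower b0 K4 Kbig).
  - exact: Gammai_hat_diag_ge0.
  - rewrite (le_trans (trace_Gammai_hat_le i noiseN))// ler_wpM2l//.
    by rewrite lerD2l.
  - by move=> f; exact: flat_event_grid.
exact: noise_group_norm_le.
Qed.

(** The grid has at most [exp ((D + 2) m d)] points; half of the exponent of
    [exp (- n beta / 4)] pays for them. *)
Lemma flat_event_small D : ((D + 2) * (m * d))%:R <= n%:R * beta / 8 ->
  (d <= n)%N -> (P (flat_event D) <= (128 / (beta ^+ 2 * n%:R))%:E)%E.
Proof.
move=> grid_small dn; rewrite (le_trans (flat_event_le D))// lee_fin.
have beta0 : 0 < beta by rewrite divr_gt0 ?exprn_gt0// mulr_gt0// exprn_gt0.
have n_gt0 : 0 < n%:R :> R by rewrite ltr0n.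
have pow2 (N : nat) : 2 ^+ N <= expR N%:R :> R.
  rewrite -[N%:R]mulr1 expRM_natl lerXn2r ?nnegrE ?expR_ge0//.
  by have := expR_ge1Dx (1 : R); lra.
have y0 : 0 < n%:R * beta / 8 by rewrite divr_gt0// mulr_gt0.
apply: (@le_trans _ _ (n%:R * expR (- (n%:R * beta / 8)))).
  apply: ler_pM; rewrite ?ler_nat ?mulr_ge0 ?exprn_ge0 ?expR_ge0//.
  rewrite (le_trans (ler_wpM2r (expR_ge0 _) (pow2 _)))// -expRD ler_expR.
  lra.
rewrite (le_trans (ler_wpM2l (ltW n_gt0) (expRN_le_sqr_inv y0)))//.
rewrite le_eqVlt; apply/orP; left; apply/eqP; field.
by rewrite !gt_eqF.
Qed.

Lemma error_event (c t lambda rho : R) (K : nat) (S : {set 'I_d * 'I_d}) :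
  0 <= t <= nu -> 0 <= lambda ->
  (4 <= K)%N -> 8 * (2 * sg ^+ 2 + nu) <= beta * eps / 16 * K%:R ->
  rho = beta * eps / 16 / 8 ->
  (forall k, (P (K_dev t k) <= (expR (- (c * n%:R * t ^+ 2)))%:E)%E) ->
  (forall i (k l : 'I_(cdim i)),
     (P (Gammai_dev t k l) <= (expR (- (c * n%:R * t ^+ 2)))%:E)%E) ->
  ((4 * K + 2) * (m * d))%:R <= n%:R * beta / 8 -> (d <= n)%N ->
  (forall k, group_of k \notin S -> thetas k 0 = 0) ->
  let gamma := Num.sqrt m%:R * (t + 2 * t * kappa1 thetas) in
  gamma <= lambda \/ (forall p, p \in S) ->
  exists A : set Omega, [/\ measurable A,
    (P A <= (2 * (m * d)%:R ^+ 3 * expR (- (c * n%:R * t ^+ 2))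
             + 128 / (beta ^+ 2 * n%:R))%:E)%E &
    forall w, ~ A w -> forall z,
      [set l2norm (th - thetas) | th in rsm_solutions (data w) lambda] z ->
      `|z| <= 2 * (gamma + lambda) * Num.sqrt #|S|%:R / rho].
Proof.
move=> tnu lambda0 K4 Kbig rhoE Kt Gt grid_small dn supp gamma absorb.
exists (noise_event t `|` flat_event (4 * K)).
have mN := measurable_noise_event t; have mF := measurable_flat_event (4 * K).
split; first exact: measurableU.
  rewrite (le_trans (measureU2 P mN mF))// EFinD leeD//.
    by apply: noise_event_le; rewrite ?expR_ge0.
  exact: flat_event_small.
move=> w /not_orP[wN wF] z [th sol <-]; rewrite ger0_norm ?sqrtr_ge0//.
exact: good_data_error tnu lambda0 K4 Kbig rhoE wN wF supp absorb sol.
Qed.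

End events.

(** * The support of a sparse parameter *)

Section support.
Variables (R : realType) (F : pairwise_family R).
Local Notation d := (nvar F).
Variable E : {set {set 'I_d}}.

Definition edge_groups : {set 'I_d * 'I_d} :=
  [set p : 'I_d * 'I_d |
     (p.1 <= p.2)%N && ((p.1 == p.2) || ([set p.1; p.2]%SET \in E))]%SET.

(** A diagonal group is given by its vertex, any other one by its edge. *)
Lemma card_edge_groups : (#|edge_groups| <= d + #|E|)%N.
Proof.
pose A := [set p : 'I_d * 'I_d | p.1 == p.2]%SET.
pose B := [set p : 'I_d * 'I_d | (p.1 <= p.2)%N && ([set p.1; p.2]%SET \in E)]%SET.
have SAB : (edge_groups \subset (A :|: B)%SET).
  apply/fintype.subsetP => p; rewrite !inE => /andP[-> /orP[->//|->]].
  by rewrite orbT.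
rewrite (leq_trans (subset_leq_card SAB))// cardsU (leq_trans (leq_subr _ _))//.
apply: leq_add.
  rewrite -[leqRHS]card_ord -(card_in_imset (f := fst)); first exact: max_card.
  move=> [i j] [i' j']; rewrite !inE /= => /eqP -> /eqP -> /=.
  by move=> ->.
rewrite -(card_in_imset (f := fun p => [set p.1; p.2]%SET)).
  apply: subset_leq_card; apply/fintype.subsetP => e /imsetP[p].
  by rewrite inE => /andP[_ pE] ->.
move=> [i j] [i' j']; rewrite !inE /= => /andP[ij _] /andP[ij' _] eq2.
have := set21 i j; have := set22 i j; have := set21 i' j'; have := set22 i' j'.
rewrite {1 2}eq2 -{1 2}eq2 !inE -!val_eqE /= => h1 h2 h3 h4.
congr (_, _); apply: val_inj => /=; move: ij ij' h1 h2 h3 h4; lia.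
Qed.

Lemma edge_groups_support (theta : 'cV[R]_(pdim F)) :
  (forall k, let: (i, j) := group_of k in
     i != j -> [set i; j]%SET \notin E -> theta k 0 = 0) ->
  forall k, group_of k \notin edge_groups -> theta k 0 = 0.
Proof.
move=> sparse k; rewrite inE group_of_le /= negb_or => /andP[ij ijE].
by have := sparse k; rewrite (surjective_pairing (group_of k)); apply.
Qed.

End support.

(** * Rates *)

Section rates.
Variable R : realType.

Lemma sqr_sqrt_ln (c tau : R) (q n : nat) : (0 < q)%N -> (0 < n)%N ->
  c * n%:R * (tau * Num.sqrt (ln q%:R / n%:R)) ^+ 2 = c * tau ^+ 2 * ln q%:R.
Proof.
move=> q0 n0; rewrite exprMn sqr_sqrtr ?divr_ge0 ?ln_ge0 ?ler1n//; field.
by rewrite pnatr_eq0 -lt0n.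
Qed.

(** The deviation of [K_hat] does not carry the factor [kappa]; the lower bound
    [kappa0] lets the rate absorb it. *)
Lemma noise_level_le (m q n : nat) (kappa kappa0 tau t : R) :
  0 < kappa0 -> kappa0 <= kappa -> 0 <= tau -> (0 < q)%N ->
  t = tau * Num.sqrt (ln q%:R / n%:R) ->
  Num.sqrt m%:R * (t + 2 * t * kappa) <= tau * (kappa0^-1 + 2) *
    Num.sqrt (m%:R * kappa ^+ 2 * ln q%:R / n%:R).
Proof.
move=> k0 kk tau0 q0 ->.
have kappa_gt0 : 0 < kappa by exact: lt_le_trans kk.
have kappa_ge0 := ltW kappa_gt0.
have lnq : 0 <= ln q%:R / n%:R :> R by rewrite divr_ge0 ?ln_ge0 ?ler1n.
have -> : Num.sqrt (m%:R * kappa ^+ 2 * ln q%:R / n%:R) =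
    Num.sqrt m%:R * kappa * Num.sqrt (ln q%:R / n%:R).
  rewrite -(mulrA (m%:R * kappa ^+ 2)) sqrtrM ?mulr_ge0 ?sqr_ge0//.
  by rewrite sqrtrM ?ler0n// sqrtr_sqr gtr0_norm.
set s := Num.sqrt (ln q%:R / n%:R); set u := Num.sqrt m%:R.
have -> : u * (tau * s + 2 * (tau * s) * kappa) = tau * u * s * (1 + 2 * kappa).
  by ring.
have -> : tau * (kappa0^-1 + 2) * (u * kappa * s) =
  tau * u * s * (kappa0^-1 * kappa + 2 * kappa) by ring.
by rewrite ler_wpM2l ?mulr_ge0 ?sqrtr_ge0// lerD2r ler_pdivlMl// mulr1.
Qed.

Lemma rate_factor (a m q n : nat) (kappa : R) : (0 < q)%N ->
  Num.sqrt (a%:R * m%:R * kappa ^+ 2 * ln q%:R / n%:R) =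
  Num.sqrt a%:R * Num.sqrt (m%:R * kappa ^+ 2 * ln q%:R / n%:R).
Proof. by move=> q0; rewrite -sqrtrM// !mulrA. Qed.

End rates.

Theorem theorem5p5 (R : realType)
  (eps_lo eps_hi c1 c2 nu sg kappa0 : R)
  (eps_lo_gt0 : 0 < eps_lo) (c1_gt0 : 0 < c1) (c2_gt0 : 0 < c2)
  (nu_gt0 : 0 < nu) (sg_gt0 : 0 < sg) (kappa0_gt0 : 0 < kappa0) :
  (* the suitably large implied constants of lambda_n and of n = Omega(md) *)
  exists L0 N0 : R, [/\ 0 < L0, 0 < N0 &
  forall (L1 L2 : R), L0 <= L1 -> L1 <= L2 ->
  forall (F : nat -> pairwise_family R)
    (E : forall n, {set {set 'I_(nvar (F n))}})
    (pstar : forall n, probability (borel_rV R (nvar (F n))) R)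
    (disp : nat -> measure_display)
    (Omega : forall n, measurableType (disp n))
    (P : forall n, probability (Omega n) R)
    (X : forall n, 'I_n -> {mfun Omega n >-> borel_rV R (nvar (F n))})
    (lambda : nat -> R),
  let d n := nvar (F n) in
  let m n := width (F n) in
  let thetas n := theta_star (pstar n) in
  let kappa n := kappa1 (thetas n) in
  let data n (w : Omega n) (r : 'I_n) : 'rV[R]_(d n) := X n r w in
  (* setting *)
  (forall n (e : {set 'I_(d n)}), e \in E n -> #|e| = 2%N) ->
  (forall n k, (pstar n).-integrable [set: borel_rV R (d n)]
     (fun x => (K_vec (F := F n) x k 0)%:E)) ->
  (forall n, iid_sample (P n) (pstar n) (@X n)) ->
  (* 1. eigenvalue bounds *)
  (forall n (i : 'I_(d n)),
     [/\ Lambda_max (Gammai_star (pstar n) i) <= eps_hi,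
         Lambda_min (Gammai_star (pstar n) i)
           <= Lambda_max (Gammai_star (pstar n) i) &
         eps_lo <= Lambda_min (Gammai_star (pstar n) i)]) ->
  (* 2. sparsity *)
  (forall n k, let: (i, j) := group_of k in
     i != j -> [set i; j]%SET \notin E n -> thetas n k 0 = 0) ->
  (* 3. concentration *)
  (forall n (t : R), 0 <= t <= nu ->
     (forall k, (P n [set w |
          (t <= `|K_hat (F := F n) (data n w) k 0 - K_star (pstar n) k 0|)%R]
        <= (expR (- (c1 * n%:R * t ^+ 2)))%:E)%E) /\
     (forall (i : 'I_(d n)) k l, (P n [set w |
          (t <= `|Gammai_hat (data n w) i k l
                  - Gammai_star (pstar n) i k l|)%R]
        <= (expR (- (c2 * n%:R * t ^+ 2)))%:E)%E)) ->
  (* 4. sub-Gaussianity *)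
  (forall n (i : 'I_(d n)) (r : 'I_n),
     subgaussian_vec (P n) (fun w => a_vec i (data n w r)) sg) ->
  (* nondegeneracy of the rate *)
  (\forall n \near \oo, kappa0 <= kappa n) ->
  (\forall n \near \oo, (1 < m n * d n)%N) ->
  (* regularization parameter and sample size *)
  (\forall n \near \oo,
     let rate :=
       Num.sqrt ((m n)%:R * kappa n ^+ 2 * ln (m n * d n)%:R / n%:R) in
     L1 * rate <= lambda n <= L2 * rate) ->
  (\forall n \near \oo, N0 * (m n * d n)%:R <= n%:R) ->
  bigO_p P
    (fun n w => [set l2norm (th - thetas n) | th in
                   rsm_solutions (F := F n) (data n w) (lambda n)])
    (fun n => Num.sqrt ((d n + #|E n|)%:R * (m n)%:R * kappa n ^+ 2
                        * ln (m n * d n)%:R / n%:R))].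
Proof.
pose c := Num.min c1 c2.
have c0 : 0 < c by rewrite lt_min c1_gt0.
pose beta := eps_lo ^+ 2 / (8 * sg ^+ 4).
have beta0 : 0 < beta by rewrite divr_gt0 ?exprn_gt0// mulr_gt0// exprn_gt0.
pose b := beta * eps_lo / 16.
have b0 : 0 < b by rewrite divr_gt0// mulr_gt0.
(* [K * p] is the squared norm to which vectors are scaled before rounding; the
   trace, at most [p * (2 * sg ^+ 2 + nu)], must be small against [b * K * p]. *)
have [K [K4 Kbig]] : exists K : nat,
    (4 <= K)%N /\ 8 * (2 * sg ^+ 2 + nu) <= b * K%:R.
  exists (4 + Num.bound (8 * (2 * sg ^+ 2 + nu) / b))%N; split=> //.
  have T0 : 0 <= 8 * (2 * sg ^+ 2 + nu) / b.
    by rewrite divr_ge0 ?(ltW b0)//; have := sqr_ge0 sg; lra.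
  have := archi_boundP T0; rewrite ltr_pdivrMr// => /ltW/le_trans; apply.
  by rewrite mulrC ler_pM2l// ler_nat leq_addl.
pose rho := b / 8.
have rho0 : 0 < rho by rewrite divr_gt0.
(* With [c * taua ^+ 2 = 4] the union bound over [2 (m d)^3] entries leaves the
   probability [2 / (m d)]. *)
pose taua := Num.sqrt (4 / c).
have taua0 : 0 < taua by rewrite sqrtr_gt0 divr_gt0.
pose a := kappa0^-1 + 2.
have a0 : 0 < a by rewrite addr_gt0// invr_gt0.
(* The second term beats the cardinality of the grids, the third one keeps the
   deviation [t] below [nu]. *)
pose N0 := 1 + 8 * (4 * K + 2)%:R / beta + taua ^+ 2 / nu ^+ 2.
have N0a : 0 <= 8 * (4 * K + 2)%:R / beta by rewrite divr_ge0 ?(ltW beta0)// mulr_ge0.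
have N0b : 0 <= taua ^+ 2 / nu ^+ 2 by rewrite divr_ge0 ?sqr_ge0.
have N0_ge1 : 1 <= N0 by rewrite /N0; lra.
have N0_gea : 8 * (4 * K + 2)%:R / beta <= N0 by rewrite /N0; lra.
have N0_geb : taua ^+ 2 / nu ^+ 2 <= N0 by rewrite /N0; lra.
exists (taua * a), N0; split; [by rewrite mulr_gt0|exact: lt_le_trans N0_ge1|].
move=> L1 L2 L01 L12 F E pstar disp Omega P X lambda d m thetas kappa data.
move=> _ KI iid eig sparse conc sgX kappa_lo md lam size e e0.
have L2_gt0 : 0 < L2 by rewrite (lt_le_trans _ (le_trans L01 L12))// mulr_gt0.
(* [D] separates the regimes of large and of bounded [m d]. In the latter
   [taub] makes [2 D^3 exp (- c taub^2 ln 2)], a bound for the probability of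
   large noise, at most [e / 2]. *)
have [D DE] : exists D : R, D = 4 / e by exists (4 / e).
have D0 : 0 < D by rewrite DE divr_gt0.
have ln2 : 0 < ln (2 : R) by rewrite ln_gt0// ltr1n.
pose taub := Num.sqrt (4 * D ^+ 3 / (e * c * ln 2)).
have taub2 : c * taub ^+ 2 * ln 2 = 4 * D ^+ 3 / e.
  rewrite sqr_sqrtr; first by field; rewrite !gt_eqF.
  by rewrite ltW// divr_gt0 ?mulr_gt0 ?exprn_gt0.
have taub0 : 0 <= taub by exact: sqrtr_ge0.
pose Ma := 4 * L2 / rho; pose Mb := 2 * (taub * a + L2) * D / rho.
have Ma0 : 0 < Ma by rewrite divr_gt0// mulr_gt0.
have Mb0 : 0 < Mb by rewrite divr_gt0// !mulr_gt0// ltr_wpDl// mulr_ge0 ?(ltW a0).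
exists (Ma + Mb); first by rewrite addr_gt0.
have large1 := nbhs_infty_ger (256 / (beta ^+ 2 * e)).
have large2 := nbhs_infty_ger (taub ^+ 2 * D / nu ^+ 2).
near=> n.
have kn : kappa0 <= kappa n by near: n.
have qn : (1 < m n * d n)%N by near: n.
have lamn : let rate :=
       Num.sqrt ((m n)%:R * kappa n ^+ 2 * ln (m n * d n)%:R / n%:R) in
     L1 * rate <= lambda n <= L2 * rate by near: n.
have sizen : N0 * (m n * d n)%:R <= n%:R by near: n.
have n1 : 256 / (beta ^+ 2 * e) <= n%:R by near: n; exact: large1.
have n2 : taub ^+ 2 * D / nu ^+ 2 <= n%:R by near: n; exact: large2.
set q := (m n * d n)%N in qn lamn sizen.
set r0 := Num.sqrt ((m n)%:R * kappa n ^+ 2 * ln q%:R / n%:R) in lamn.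
have r00 : 0 <= r0 by exact: sqrtr_ge0.
move: lamn => /andP[lam_lo lam_hi].
have lam0 : 0 <= lambda n.
  by rewrite (le_trans _ lam_lo)// mulr_ge0// (le_trans _ L01)// mulr_ge0// ltW.
have q0 : (0 < q)%N by exact: ltnW.
have [m0 d0] : (0 < m n)%N /\ (0 < d n)%N.
  by move: q0; rewrite /q muln_gt0 => /andP[].
have qR : 0 < q%:R :> R by rewrite ltr0n.
have q_le_n : q%:R <= n%:R :> R.
  by rewrite (le_trans _ sizen)// ler_peMl.
have n0 : (0 < n)%N by rewrite (leq_trans q0)// -(ler_nat R).
have nR : 0 < n%:R :> R by rewrite ltr0n.
have dn : (d n <= n)%N.
  by rewrite (leq_trans (leq_pmull _ m0))// -(ler_nat R).
have grid_small : ((4 * K + 2) * q)%:R <= n%:R * beta / 8.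
  rewrite natrM; have : (8 * (4 * K + 2)%:R / beta) * q%:R <= n%:R.
    by rewrite (le_trans _ sizen)// ler_wpM2r.
  rewrite mulrAC (ler_pdivrMr _ _ beta0) => h.
  by rewrite ler_pdivlMr// [leLHS]mulrC mulrA.
(* Both regimes apply the bound on the error with a noise level [tau] and a set
   of groups [S] of their own. *)
have key (tau : R) (S : {set 'I_(d n) * 'I_(d n)}) : 0 <= tau ->
    tau ^+ 2 * (ln q%:R / n%:R) <= nu ^+ 2 ->
    2 * q%:R ^+ 3 * expR (- (c * tau ^+ 2 * ln q%:R)) <= e / 2 ->
    (forall k, group_of k \notin S -> thetas n k 0 = 0) ->
    tau * a * r0 <= lambda n \/ (forall p, p \in S) ->
    2 * (tau * a + L2) * Num.sqrt #|S|%:R / rho <=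
      (Ma + Mb) * Num.sqrt (d n + #|E n|)%:R ->
    exists A : set (Omega n), [/\ measurable A, (P n A <= e%:E)%E &
      forall w, ~ A w -> forall z,
        [set l2norm (th - thetas n) | th in
           rsm_solutions (F := F n) (data n w) (lambda n)] z ->
        `|z| <= (Ma + Mb) * (Num.sqrt (d n + #|E n|)%:R * r0)].
  move=> tau0 tau_nu small supp absorb const.
  pose t := tau * Num.sqrt (ln q%:R / n%:R).
  have lnq : 0 <= ln q%:R / n%:R :> R by rewrite divr_ge0 ?ln_ge0 ?ler1n.
  have t0 : 0 <= t by rewrite mulr_ge0 ?sqrtr_ge0.
  have tnu : t <= nu.
    rewrite -(@ler_pXn2r _ 2) ?nnegrE ?(ltW nu_gt0)//.
    by rewrite exprMn sqr_sqrtr.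
  have t0nu : 0 <= t <= nu by rewrite t0.
  have [cK cG] := conc n t t0nu.
  have cmin (c' : R) : c <= c' ->
      expR (- (c' * n%:R * t ^+ 2)) <= expR (- (c * n%:R * t ^+ 2)).
    by move=> cc; rewrite ler_expR lerN2 ler_wpM2r ?sqr_ge0// ler_wpM2r.
  pose gamma := Num.sqrt (m n)%:R * (t + 2 * t * kappa n).
  have gamma_le : gamma <= tau * a * r0 by exact: noise_level_le.
  have absorb' : gamma <= lambda n \/ (forall p, p \in S).
    by case: absorb => [h|h]; [left; exact: le_trans h|right].
  have Kt k : (P n (K_dev (pstar n) (@X n) t k) <=
      (expR (- (c * n%:R * t ^+ 2)))%:E)%E.
    by rewrite (le_trans (cK k))// lee_fin cmin// /c ge_min lexx.
  have Gt i (k l : 'I_(cdim i)) : (P n (Gammai_dev (pstar n) (@X n) t k l) <=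
      (expR (- (c * n%:R * t ^+ 2)))%:E)%E.
    by rewrite (le_trans (cG i k l))// lee_fin cmin// /c ge_min lexx orbT.
  have eps_lo_le i : eps_lo <= Lambda_min (Gammai_star (pstar n) i).
    by have [] := eig n i.
  have [A [mA PA AZ]] := error_event eps_lo_gt0 sg_gt0 n0 (iid n) (KI n)
    eps_lo_le (sgX n) t0nu lam0 K4 Kbig (erefl rho) Kt Gt grid_small dn supp absorb'.
  exists A; split=> //.
    rewrite (le_trans PA)// lee_fin sqr_sqrt_ln//.
    have beta2 : 0 < beta ^+ 2 by exact: exprn_gt0.
    have bn : 0 < beta ^+ 2 * n%:R by exact: mulr_gt0.
    have be : 0 < beta ^+ 2 * e by exact: mulr_gt0.
    rewrite [leRHS]splitr lerD// (ler_pdivrMr _ _ bn).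
    move: n1; rewrite (ler_pdivrMr _ _ be).
    have -> : 256 = 128 * 2 :> R by rewrite -natrM.
    rewrite -ler_pdivlMr// => /le_trans; apply; rewrite le_eqVlt; apply/orP; left.
    by apply/eqP; ring.
  move=> w wA z zZ; rewrite (le_trans (AZ w wA z zZ))//.
  apply: (@le_trans _ _ (2 * (tau * a + L2) * Num.sqrt #|S|%:R / rho * r0)).
    have -> : 2 * (tau * a + L2) * Num.sqrt #|S|%:R / rho * r0 =
      2 * (tau * a * r0 + L2 * r0) * Num.sqrt #|S|%:R / rho by ring.
    rewrite ler_pM2r ?invr_gt0// ler_wpM2r ?sqrtr_ge0// ler_pM2l//.
    by rewrite lerD.
  by rewrite mulrA ler_wpM2r.
have -> : Num.sqrt ((d n + #|E n|)%:R * (m n)%:R * kappa n ^+ 2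
    * ln (m n * d n)%:R / n%:R) = Num.sqrt (d n + #|E n|)%:R * r0.
  exact: rate_factor.
have E0 : 0 <= Num.sqrt (d n + #|E n|)%:R :> R by exact: sqrtr_ge0.
have lnq_le : ln q%:R <= q%:R :> R.
  exact/ltW/ln_sublinear.
have [Dq|qD] := leP D q%:R.
(* [m d] is large: [lambda] dominates the noise with high probability. *)
  apply: (key taua (edge_groups (E n)) (ltW taua0)).
  - rewrite mulrA ler_pdivrMr//.
    have : taua ^+ 2 / nu ^+ 2 * q%:R <= n%:R.
      by rewrite (le_trans _ sizen)// ler_wpM2r.
    rewrite mulrAC ler_pdivrMr ?exprn_gt0// [X in _ -> _ <= X]mulrC.
    by apply: le_trans; rewrite ler_wpM2l ?sqr_ge0.
  - have -> : c * taua ^+ 2 = 4.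
      by rewrite sqr_sqrtr ?divr_ge0 ?(ltW c0)//; field; rewrite gt_eqF.
    rewrite expRN expRM_natl lnK ?posrE//.
    have -> : 2 * q%:R ^+ 3 / q%:R ^+ 4 = 2 / q%:R :> R by field; rewrite gt_eqF.
    rewrite ler_pdivrMr//; move: Dq; rewrite DE ler_pdivrMr// => h.
    by rewrite mulrAC ler_pdivlMr// [leRHS]mulrC -natrM.
  - by apply: edge_groups_support => k; exact: sparse.
  - by left; rewrite (le_trans _ lam_lo)// ler_wpM2r.
  apply: (@le_trans _ _ (Ma * Num.sqrt (d n + #|E n|)%:R)); last first.
    by rewrite ler_wpM2r// lerDl ltW.
  rewrite [leRHS]mulrAC ler_pM2r ?invr_gt0//; apply: ler_pM.
  - by rewrite ltW// mulr_gt0// addr_gt0// mulr_gt0.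
  - exact: sqrtr_ge0.
  - have -> : 4 * L2 = 2 * (L2 + L2) by ring.
    by rewrite ler_pM2l// lerD2r (le_trans L01).
  - by rewrite ler_wsqrtr// ler_nat card_edge_groups.
(* [m d] is bounded: [lambda] may be below the noise, but the set of all groups
   has at most [D ^+ 2] elements. *)
have nu2 : 0 < nu ^+ 2 by exact: exprn_gt0.
apply: (key taub [set: 'I_(d n) * 'I_(d n)]%SET taub0).
- rewrite mulrA ler_pdivrMr// [leRHS]mulrC.
  move: n2; rewrite (ler_pdivrMr _ _ nu2); apply: le_trans.
  by rewrite ler_wpM2l ?sqr_ge0// (le_trans lnq_le)// ltW.
- have D3 : 0 < 4 * D ^+ 3 / e by rewrite divr_gt0// mulr_gt0// exprn_gt0.
  apply: (@le_trans _ _ (2 * D ^+ 3 * expR (- (4 * D ^+ 3 / e)))).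
    apply: ler_pM; rewrite ?expR_ge0 ?mulr_ge0 ?exprn_ge0//.
      by rewrite ler_pM2l// lerXn2r ?nnegrE ?(ltW D0)// ltW.
    rewrite ler_expR lerN2 -taub2 ler_wpM2l ?mulr_ge0 ?sqr_ge0 ?(ltW c0)//.
    by rewrite ler_ln ?posrE// ler_nat.
  apply: (@le_trans _ _ (2 * D ^+ 3 * (4 * D ^+ 3 / e)^-1)).
    by rewrite ler_wpM2l ?expRN_le_inv// mulr_ge0// exprn_ge0// ltW.
  rewrite le_eqVlt; apply/orP; left; apply/eqP; field.
  by rewrite !gt_eqF.
- by move=> k; rewrite inE.
- by right=> p; rewrite inE.
have M0 : 0 <= 2 * (taub * a + L2).
  by rewrite mulr_ge0// addr_ge0 ?(ltW L2_gt0)// mulr_ge0// ltW.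
apply: (@le_trans _ _ (Mb * 1)).
  rewrite mulr1 ler_pM2r ?invr_gt0//; apply: ler_wpM2l => //.
  rewrite cardsT card_prod card_ord natrM -expr2 sqrtr_sqr ger0_norm//.
  by rewrite (le_trans _ (ltW qD))// ler_nat leq_pmull.
apply: ler_pM => //; first exact: ltW.
  by rewrite lerDr ltW.
rewrite -[leLHS]sqrtr1 ler_wsqrtr// (ler_nat _ 1) (leq_trans d0)// leq_addr.
Unshelve. all: by end_near.
Qed.
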